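(* Let $m,\nu,\mu,\lambda\in\mathbb{R}$, $k\in\mathbb{Z}\setminus\{0\}$, $\delta:=(k+\lambda)^2+\mu^2-\nu^2$ with $0<\delta<\tfrac14$, and $\gamma:=\sqrt{\delta}$, so that $0<\gamma<\tfrac12$. Let $(t(\theta))_{\theta\in[0,\pi)}$ be the one (real) parameter family of self-adjoint extensions of $h$ defined in the context. For $\theta\in[0,\pi)$ the following are equivalent: (i) $\theta=0$; (ii) $\mathcal{D}(t(\theta))\subseteq\mathcal{D}(r^{-1/2})^2$; (iii) $\mathcal{D}(t(\theta))\subseteq\mathcal{D}(r^{-a})^2$ for every $a\in\left[\tfrac12,\tfrac12+\gamma\right)$; (iv) for any $(f^+,f^-)\in\mathcal{D}(t(\theta))$, setting $$\varphi^-:=\begin{cases}(\nu+\mu)f^++(k+\lambda-\gamma)f^- & \text{if }k+\lambda-\gamma\neq0,\\ -2\gamma f^++(-\nu+\mu)f^- & \text{if }k+\lambda-\gamma=0,\end{cases}$$ we have $\varphi^-\in\mathcal{J}$, where $$\mathcal{J}=\left\{u\in AC[0,M]\text{ for any }M>0:\ \tfrac{u}{r},\,u'\in L^2(0,+\infty)\right\}.$$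
   Context: All operators act in $L^2(0,+\infty)^2=L^2((0,+\infty);\mathbb{C}^2)$; $\mathcal{D}(\cdot)$ denotes the domain. $AC[0,M]$ is the space of (complex-valued) absolutely continuous functions on $[0,M]$. For $a\in\mathbb{R}$, $\mathcal{D}(r^{-a})=\{f\in L^2(0,+\infty): r^{-a}f\in L^2(0,+\infty)\}$. The integer $k$ is the index $k=k_j=\pm(j+1/2)$, $j\in\{1/2,3/2,\dots\}$, of a partial wave subspace (the paper writes $h_{m_j,k_j}$, $t(\theta)_{m_j,k_j}$, $f^\pm_{m_j,k_j}$, etc.). Minimal operator: $\mathcal{D}(h)=C_c^\infty(0,+\infty)^2$, and $$h\begin{pmatrix} f^+\\ f^-\end{pmatrix}=\begin{pmatrix} m+\frac{\nu+\mu}{r} & -\partial_r+\frac{k+\lambda}{r}\\ \partial_r+\frac{k+\lambda}{r} & -m+\frac{\nu-\mu}{r}\end{pmatrix}\begin{pmatrix} f^+\\ f^-\end{pmatrix}.$$ Maximal operator: $h^*$ is given by the same expression in the sense of distributions on $(0,+\infty)$, with $\mathcal{D}(h^* )=\{(f^+,f^-)\in L^2(0,+\infty)^2 : h^*(f^+,f^-)\in L^2(0,+\infty)^2\}$; it is the adjoint of $h$. Elements of $\mathcal{D}(h^* )$ are identified with their continuous representatives on $(0,+\infty)$. The family $t(\theta)$, $\theta\in[0,\pi)$: $t(\theta)$ is the restriction of $h^*$ to the set $\mathcal{D}(t(\theta))$ of all $(f^+,f^-)\in\mathcal{D}(h^* )$ for which there exists $(A^+,A^-)\in\mathbb{C}^2$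 with $$A^+\sin\theta+A^-\cos\theta=0,\qquad \lim_{r\to0}\left|\begin{pmatrix} f^+(r)\\ f^-(r)\end{pmatrix}-D\begin{pmatrix} A^+r^{\gamma}\\ A^-r^{-\gamma}\end{pmatrix}\right|r^{-1/2}=0,$$ where $$D:=\begin{cases}\dfrac{1}{2\gamma(\lambda+k-\gamma)}\begin{pmatrix}\lambda+k-\gamma & \nu-\mu\\ -(\nu+\mu) & -(\lambda+k-\gamma)\end{pmatrix} & \text{if }\lambda+k-\gamma\ne0,\\[3mm] \dfrac{1}{-4\gamma^2}\begin{pmatrix}\mu-\nu & 2\gamma\\ 2\gamma & -(\nu+\mu)\end{pmatrix} & \text{if }\lambda+k-\gamma=0.\end{cases}$$ These are self-adjoint extensions of $h$. *)

(* Defs.v *)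
From HB Require Import structures.
From mathcomp Require Import all_boot all_order all_algebra.
From mathcomp Require Import all_classical all_reals all_analysis.
From mathcomp Require Import complex.
Set Implicit Arguments.
Unset Strict Implicit.
Unset Printing Implicit Defensive.
Import Order.TTheory GRing.Theory Num.Theory numFieldNormedType.Exports.
Import Normc.
Local Open Scope classical_set_scope.
Local Open Scope ring_scope.
Local Open Scope complex_scope.

(* Functions on the half-line are represented by total functions R -> R[i] whose
   values outside ]0, +oo[ are irrelevant; test functions are extended by 0. *)

Section HalfLine.
Context {R : realType}.
Implicit Types (f u : R -> R[i]) (a r : R).

Definition reF f : R -> R := fun r => complex.Re (f r).
Definition imF f : R -> R := fun r => complex.Im (f r).

Definition L2 f : Prop :=
  [/\ measurable_fun (`]0, +oo[ : set R) (reF f),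
      measurable_fun (`]0, +oo[ : set R) (imF f) &
      (\int[lebesgue_measure]_(r in `]0%R, +oo[) ((normc (f r)) ^+ 2)%:E < +oo)%E].

(* The domain of the multiplication operator r^(-a). *)
Definition dom_pow a f : Prop :=
  L2 f /\ L2 (fun r => (r `^ (- a))%:C * f r).

Definition cint f : R[i] :=
  (\int[lebesgue_measure]_(r in `]0, +oo[) reF f r)%R
  +i* (\int[lebesgue_measure]_(r in `]0, +oo[) imF f r)%R.

Definition cderive f : R -> R[i] :=
  fun r => derive1 (reF f) r +i* derive1 (imF f) r.

Definition smooth (g : R -> R) : Prop := forall n r, derivable (derive1n n g) r 1.

Definition test_fun (phi : R -> R[i]) : Prop :=
  [/\ smooth (reF phi), smooth (imF phi) &
      exists a b : R, 0 < a /\ forall r, ~~ (a <= r <= b) -> phi r = 0].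

(* Distributions on ]0, +oo[, as functionals on test functions. *)
Definition distr : Type := (R -> R[i]) -> R[i].
Definition regular f : distr := fun phi => cint (fun r => f r * phi r).
Definition ddistr (T : distr) : distr := fun phi => - T (cderive phi).
Definition distr_eq (S T : distr) : Prop :=
  forall phi, test_fun phi -> S phi = T phi.

Definition abs_cont0 (M : R) u : Prop :=
  forall e : R, 0 < e -> exists2 d : R, 0 < d &
    forall (n : nat) (a b : 'I_n -> R),
      (forall i, 0 <= a i /\ a i < b i /\ b i <= M) ->
      (forall i j, i != j -> b i <= a j \/ b j <= a i) ->
      \sum_(i < n) (b i - a i) < d ->
      \sum_(i < n) normc (u (b i) - u (a i)) < e.

(* Since u is only given on ]0, +oo[, membership in AC[0, M] asks for a value
   at 0, supplied by v; u' is any function w that is the derivative of u almost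
   everywhere. *)
Definition in_J u : Prop :=
  exists v w : R -> R[i],
    [/\ forall r, 0 < r -> v r = u r,
        forall M : R, 0 < M -> abs_cont0 M v,
        L2 (fun r => u r / r%:C),
        L2 w &
        {ae lebesgue_measure, forall r : R, 0 < r ->
           is_derive r 1 (reF u) (complex.Re (w r)) /\
           is_derive r 1 (imF u) (complex.Im (w r))}].

Definition spinor : Type := ((R -> R[i]) * (R -> R[i]))%type.

Definition spinor_L2 (F : spinor) : Prop := L2 F.1 /\ L2 F.2.

Definition spinor_dom_pow a (F : spinor) : Prop :=
  dom_pow a F.1 /\ dom_pow a F.2.

Definition spinor_continuous (F : spinor) : Prop :=
  forall r, 0 < r ->
    [/\ {for r, continuous (reF F.1)}, {for r, continuous (imF F.1)},
        {for r, continuous (reF F.2)} & {for r, continuous (imF F.2)}].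

(* Unbounded operators are represented by their graphs. *)
Definition operator : Type := spinor -> spinor -> Prop.
Definition dom (T : operator) : set spinor := [set F | exists G, T F G].

Definition mx2 (K : nmodType) (a b c d : K) : 'M[K]_2 :=
  \matrix_(i, j) nth 0 (nth [::] [:: [:: a; b]; [:: c; d]] i) j.

Definition col2 (K : nmodType) (a b : K) : 'cV[K]_2 := \col_i nth 0 [:: a; b] i.

Definition norm_C2 (v : 'cV[R[i]]_2) : R :=
  Num.sqrt (\sum_i normc (v i 0) ^+ 2).

End HalfLine.
Arguments spinor : clear implicits.
Arguments operator : clear implicits.

Section Dirac.
Context {R : realType}.
Variables (m nu mu lambda : R) (k : int).

Definition delta : R := (k%:~R + lambda) ^+ 2 + mu ^+ 2 - nu ^+ 2.
Definition gamma : R := Num.sqrt delta.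

(* The maximal operator h^*: the differential expression is taken in the sense
   of distributions, and elements of the domain are their continuous
   representatives. The value G is determined up to almost everywhere
   equality. *)
Definition h_max : operator R := fun F G =>
  [/\ spinor_L2 F, spinor_continuous F, spinor_L2 G,
      distr_eq
        (fun phi =>
           regular (fun r => (m + (nu + mu) / r)%:C * F.1 r) phi
           + (- ddistr (regular F.2) phi
              + regular (fun r => ((k%:~R + lambda) / r)%:C * F.2 r) phi))
        (regular G.1) &
      distr_eq
        (fun phi =>
           (ddistr (regular F.1) phi
            + regular (fun r => ((k%:~R + lambda) / r)%:C * F.1 r) phi)
           + regular (fun r => (- m + (nu - mu) / r)%:C * F.2 r) phi)
        (regular G.2)].

Definition Dmx : 'M[R]_2 :=
  let c := lambda + k%:~R - gamma in
  if c != 0 then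
    (2 * gamma * c)^-1 *: mx2 c (nu - mu) (- (nu + mu)) (- c)
  else
    (- 4 * gamma ^+ 2)^-1 *:
      mx2 (mu - nu) (2 * gamma) (2 * gamma) (- (nu + mu)).

Definition boundary_cond (theta : R) (F : spinor R) : Prop :=
  exists Ap Am : R[i],
    Ap * (sin theta)%:C + Am * (cos theta)%:C = 0 /\
    (norm_C2 (col2 (F.1 r) (F.2 r)
             - map_mx (real_complex R) Dmx
               *m col2 (Ap * (r `^ gamma)%:C) (Am * (r `^ (- gamma))%:C))
     * r `^ (- 2^-1)) @[r --> (0 : R)^'+] --> (0 : R).

Definition t_op (theta : R) : operator R := fun F G =>
  h_max F G /\ boundary_cond theta F.

Definition phi_minus (F : spinor R) : R -> R[i] := fun r =>
  if k%:~R + lambda - gamma != 0 then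
    (nu + mu)%:C * F.1 r + (k%:~R + lambda - gamma)%:C * F.2 r
  else
    (- 2 * gamma)%:C * F.1 r + (- nu + mu)%:C * F.2 r.

End Dirac.

(* Main.v *)
Require Import Defs.
From HB Require Import structures.
From mathcomp Require Import all_boot all_order all_algebra.
From mathcomp Require Import all_classical all_reals all_analysis.
From mathcomp Require Import measurable_realfun complex ring lra.

(** Why the four conditions are equivalent.

    Write kap = k + lambda and g = gamma. Near r = 0 the Dirac equation reads
    r F' = M F + r w with M a constant real matrix, w square integrable, and
    M has the eigenvalues g and - g; the columns of the boundary matrix are
    eigenvectors for them. The boundary condition therefore prescribes the
    ratio of the coefficients A^+ and A^- of the two solutions r^g and r^(-g)
    of the homogeneous system, up to an error o(r^(1/2)). As
    (r^(-1/2) r^(-g))^2 is not integrable at 0, while (r^(-a) r^g)^2 is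
    integrable for a < 1/2 + g, everything depends on whether the r^(-g)
    branch occurs, and it is excluded exactly when theta = 0.

    If theta = 0, the condition forces A^- = 0, so F = O(r^g) and the weighted
    integrability follows (distinguished_dom_pow). For phi^- one more remark is
    needed: its coefficients form a left eigenvector of M for - g, hence it
    solves the scalar equation u' = - g u / r + w with w in L^2, and it is
    orthogonal to the r^g branch, hence u = o(r^(1/2)). Integrating the
    derivative of u^2 / r gives the energy bound
      2 g \int (u / r)^2 <= \int w^2,
    up to a vanishing boundary term (hardy_sqint); thus u / r and u' are in
    L^2, and u is absolutely continuous up to 0 (distinguished_in_J).

    If theta <> 0, the domain contains a cut-off of the homogeneous solution
    with A^+ = - cos theta and A^- = sin theta <> 0. Its phi^- is exactly
    sin theta r^(-g) times the cut-off, which violates both the weighted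
    integrability and membership in J (singular_not_dom_pow,
    singular_not_in_J).

    The domain of the maximal operator is described by distributions, so the
    argument starts by turning the equation into an integral equation: a
    continuous function with a locally integrable distributional derivative
    is a primitive of it (weak_derivative_primitive). This is the lemma of
    du Bois-Reymond; it is proved with explicit smooth bump functions built
    from exp(- 1 / t). Local absolute continuity is handled in this integral
    form throughout, where the main tool is a product rule (primitiveM). *)

Set Implicit Arguments.
Unset Strict Implicit.
Unset Printing Implicit Defensive.
Import Order.TTheory GRing.Theory Num.Theory numFieldNormedType.Exports.
Import Normc.
Local Open Scope classical_set_scope.
Local Open Scope ring_scope.
Local Open Scope complex_scope.

(** * Primitives of locally integrable functions on the half-line *)

(** The sigma-algebra here is the one carried by the Lebesgue measure. *)
Lemma measurable_itvR {R : realType} (i : interval R) :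
  measurable ([set` i] : set (measurableTypeR R)).
Proof. exact: measurable_itv. Qed.

Definition half_line {R : realType} : set (measurableTypeR R) :=
  `]0%R, +oo[%classic.

Lemma measurable_half_line {R : realType} : measurable (@half_line R).
Proof. exact: measurable_itv. Qed.
#[local] Hint Resolve measurable_half_line : core.

Section Primitive.
Context {R : realType}.
Notation mu := (@lebesgue_measure R).
Implicit Types (u v g h : R -> R) (x y z t : R).

Definition locint g := forall x y, 0 < x -> mu.-integrable `[x, y] (EFin \o g).

(** Local absolute continuity on ]0, +oo[ with derivative g, in integral form:
    this is what the weak equation yields, and what the estimates use. *)
Definition primitive u g := locint g /\
  forall x y, 0 < x -> x <= y -> u y - u x = \int[mu]_(t in `[x, y]) g t.

Lemma segment_pos x y t : 0 < x -> t \in `[x, y] -> 0 < t.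
Proof. by move=> x0 /[!in_itv]/= /andP[/(lt_le_trans x0)]. Qed.

Lemma continuous_pos_segment g x y : 0 < x ->
  (forall t, 0 < t -> {for t, continuous g}) -> {within `[x, y], continuous g}.
Proof.
move=> x0 cg; apply: continuous_in_subspaceT => t /[!inE]/= ty.
by apply: cg; apply: segment_pos ty.
Qed.

Lemma continuous_locint g :
  (forall t, 0 < t -> {for t, continuous g}) -> locint g.
Proof.
move=> cg x y x0; apply: continuous_compact_integrable.
  exact: segment_compact.
exact: continuous_pos_segment.
Qed.

Lemma eq_locint g h : (forall t, 0 < t -> g t = h t) -> locint g -> locint h.
Proof.
move=> gh ig x y x0; apply: eq_integrable (ig x y x0) => // t.
rewrite inE => txy /=; congr EFin; apply: gh; exact: segment_pos txy.
Qed.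

Lemma locintD g h : locint g -> locint h -> locint (fun t => g t + h t).
Proof.
by move=> ig ih x y x0; exact: (integrableD _ (ig x y x0) (ih x y x0)).
Qed.

Lemma locintM g h : (forall t, 0 < t -> {for t, continuous g}) -> locint h ->
  locint (fun t => g t * h t).
Proof.
move=> cg ih x y x0; have mcg := continuous_pos_segment (y := y) x0 cg.
have mg : measurable_fun (`[x, y] : set (measurableTypeR R)) g
  by exact: subspace_continuous_measurable_fun.
have bg : [bounded g t | t in `[x, y]].
  have /compact_bounded[M [_ mrt]] := continuous_compact mcg (@segment_compact _ x y).
  by exists M; split; rewrite ?num_real // => ? ? ? ?; exact: mrt.
exact: (integrableMr (measurable_itvR _) mg bg (ih x y x0)).
Qed.

Lemma locintZ c g : locint g -> locint (fun t => c * g t).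
Proof. by apply: locintM => t _; exact: cst_continuous. Qed.

Lemma locint_norm g : locint g -> locint (fun t => `|g t|).
Proof. move=> ig x y x0; have := integrable_norm (ig x y x0); exact. Qed.

Lemma Rintegral_chasles g x y z : locint g -> 0 < x -> x <= y -> y <= z ->
  \int[mu]_(t in `[x, z]) g t =
  \int[mu]_(t in `[x, y]) g t + \int[mu]_(t in `[y, z]) g t.
Proof.
move=> ig x0 xy yz; have y0 := lt_le_trans x0 xy.
have := @Rintegral_itvB _ g (BLeft x) (BRight z) y (ig _ _ x0).
rewrite !bnd_simp => /(_ xy yz) E.
rewrite Rintegral_itv_obnd_cbnd in E; last first.
  by apply: integrableS (ig y z y0) => //; apply: subset_itvr; rewrite bnd_simp.
by rewrite -E addrC subrK.
Qed.

Lemma primitiveD u v g h : primitive u g -> primitive v h ->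
  primitive (fun t => u t + v t) (fun t => g t + h t).
Proof.
move=> [ig ug] [ih vh]; split=> [|x y x0 xy]; first exact: locintD.
rewrite (RintegralD (measurable_itvR _) (ig x y x0) (ih x y x0)).
by rewrite opprD addrACA (ug x y) ?(vh x y).
Qed.

Lemma primitiveZ c u g : primitive u g ->
  primitive (fun t => c * u t) (fun t => c * g t).
Proof.
move=> [ig ug]; split=> [|x y x0 xy]; first exact: locintZ.
by rewrite (RintegralZl c (measurable_itvR _) (ig x y x0)) -mulrBr (ug x y).
Qed.

Lemma eq_primitive u v g h : (forall t, 0 < t -> u t = v t) ->
  (forall t, 0 < t -> g t = h t) -> primitive u g -> primitive v h.
Proof.
move=> uv gh [ig ug]; split=> [|x y x0 xy]; first exact: eq_locint ig.
rewrite -!uv ?ug ?(lt_le_trans x0 xy) //; apply: eq_Rintegral => t.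
rewrite inE => txy; apply: gh; exact: segment_pos txy.
Qed.

Lemma derive_primitive u g : (forall t, 0 < t -> is_derive t 1 u (g t)) ->
  (forall t, 0 < t -> {for t, continuous g}) -> primitive u g.
Proof.
move=> du cg; split=> [|x y x0]; first exact: continuous_locint.
rewrite le_eqVlt => /predU1P[<-|xy].
  by rewrite subrr set_itv1 Rintegral_set1.
have y0 := lt_trans x0 xy.
have cu t : 0 < t -> {for t, continuous u}.
  move=> t0; apply: differentiable_continuous; apply/derivable1_diffP.
  by case: (du t t0).
rewrite /Rintegral (@continuous_FTC2 _ g u) //=.
- exact: continuous_pos_segment.
- split.
  + move=> t /[!in_itv]/= /andP[xt _]; have [] := du t (lt_trans x0 xt); exact.
  + exact/cvg_at_right_filter/cu.
  + exact/cvg_at_left_filter/cu.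
- move=> t /[!in_itv]/= /andP[xt _]; rewrite derive1E.
  by have [] := du t (lt_trans x0 xt).
Qed.

End Primitive.

Section PrimitiveContinuity.
Context {R : realType}.
Notation mu := (@lebesgue_measure R).
Implicit Types (u v g h : R -> R) (x y z t : R).

Lemma primitive_continuous u g x : primitive u g -> 0 < x ->
  {for x, continuous u}.
Proof.
move=> [ig ug] x0; pose a := x / 2; have a0 : 0 < a by rewrite divr_gt0.
have ax : a < x by rewrite /a; lra.
have ax1 : a < x + 1 by lra.
have := parameterized_integral_continuous (ltW ax1) (ig a (x + 1) a0).
move=> /(continuous_within_itvP _ ax1)[+ _ _] => /(_ x).
rewrite in_itv/= ax ltrDl ltr01 => /(_ isT) cI.
have cv : u a + parameterized_integral mu a y g @[y --> x] --> u x.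
  have -> : u x = u a + parameterized_integral mu a x g.
    by rewrite /parameterized_integral -ug ?(ltW ax)// addrC subrK.
  by apply: cvgD; [exact: cvg_cst|exact: cI].
apply: cvg_trans cv; apply: near_eq_cvg; near=> y.
have /ltW ay : a < y by near: y; exact: lt_nbhsr.
by rewrite /parameterized_integral -ug// addrC subrK.
Unshelve. all: by end_near. Qed.

(** Heine's theorem, from the near-covering form of compactness. *)
Lemma unif_continuous_segment u a b (e : R) : 0 < a -> 0 < e ->
  (forall t, 0 < t -> {for t, continuous u}) ->
  exists2 d, 0 < d & forall y z, a <= y -> y <= z -> z <= b -> z - y <= d ->
    `|u z - u y| <= e.
Proof.
move=> a0 e0 cu.
pose P d y := forall z, y <= z -> z - y <= d -> `|u z - u y| <= e.
have loc x : `[a, b]%classic x -> \forall y \near x & d \near (0 : R)^'+, P d y.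
  move=> /= xab; have x0 : 0 < x by exact: segment_pos xab.
  have /cvgrPdist_lt/(_ (e / 2)) := cu x x0.
  rewrite divr_gt0// => /(_ isT)[r /= r0 Hr].
  exists (ball x (r / 2), [set d | d < r / 2]) => /=.
    split; first by apply: nbhsx_ballx; rewrite divr_gt0.
    by apply: nbhs_right_lt; rewrite divr_gt0.
  move=> [y d]/= [xy dr] z yz zd.
  have hy : `|u x - u y| < e / 2.
    by apply: Hr; move: xy; rewrite /ball/= => /lt_le_trans; apply; lra.
  have hz : `|u x - u z| < e / 2.
    apply: Hr; rewrite /ball/=; move: xy; rewrite /ball/= !ltr_norml => /andP[].
    by move=> *; apply/andP; split; lra.
  rewrite (_ : u z - u y = (u x - u y) - (u x - u z)); last by ring.
  by rewrite (le_trans (ler_normB _ _))//; lra.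
have /compact_near_coveringP nc := @segment_compact _ a b.
have [d /= d0 H] := nc _ _ P _ loc.
exists (d / 2); first by rewrite divr_gt0.
move=> y z ay yz zb zyd; apply: (H (d / 2)) => //=.
- by rewrite sub0r normrN gtr0_norm ?divr_gt0//; lra.
- by rewrite divr_gt0.
- by rewrite in_itv/= ay (le_trans yz).
Qed.

End PrimitiveContinuity.

Section PrimitiveProduct.
Context {R : realType}.
Notation mu := (@lebesgue_measure R).
Implicit Types (u v g h : R -> R) (x y z t : R).

Lemma le_norm_locint g h x y : locint g -> locint h -> 0 < x ->
  (forall t, x <= t <= y -> `|g t| <= h t) ->
  `|\int[mu]_(t in `[x, y]) g t| <= \int[mu]_(t in `[x, y]) h t.
Proof.
move=> ig ih x0 gh.
apply: le_trans (le_normr_Rintegral (measurable_itvR _) (ig x y x0)) _.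
apply: (le_Rintegral (measurable_itvR _) (locint_norm ig y x0) (ih x y x0)).
by move=> t /= /[!in_itv]/=; exact: gh.
Qed.

(** The product rule without pointwise derivatives. On a short segment [x, y]
    the increment of u v is the integral of v(y) g + u(x) h, which differs from
    the integral of g v + u h by at most the oscillation of u and v times the
    integral of |g| + |h|. The defect E is additive in the segment, so these
    local bounds add up along a uniform subdivision. *)
Lemma primitiveM u v g h : primitive u g -> primitive v h ->
  primitive (fun t => u t * v t) (fun t => g t * v t + u t * h t).
Proof.
move=> pu pv; have [ig ug] := pu; have [ih vh] := pv.
have cu t : 0 < t -> {for t, continuous u} by exact: primitive_continuous pu.
have cv t : 0 < t -> {for t, continuous v} by exact: primitive_continuous pv.
have iF : locint (fun t => g t * v t + u t * h t).
  apply: locintD; last exact: locintM.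
  by apply: (@eq_locint _ (fun t => v t * g t));
    [move=> t _; rewrite mulrC|exact: locintM].
split=> // a b a0 ab.
set F := fun t => _ in iF *.
pose N := fun t => `|g t| + `|h t|.
have iN : locint N by apply: locintD; exact: locint_norm.
pose E x y := u y * v y - u x * v x - \int[mu]_(t in `[x, y]) F t.
have loc x y e : 0 < x -> x <= y ->
    (forall t, x <= t <= y -> `|u x - u t| <= e /\ `|v y - v t| <= e) ->
    `|E x y| <= e * \int[mu]_(t in `[x, y]) N t.
  move=> x0 xy osc.
  have igc c : locint (fun t => c * g t) by exact: locintZ.
  have ihc c : locint (fun t => c * h t) by exact: locintZ.
  have iK : locint (fun t => v y * g t + u x * h t) by exact: locintD.
  have -> : E x y = \int[mu]_(t in `[x, y]) (v y * g t + u x * h t - F t).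
    rewrite (RintegralB (measurable_itvR _) (iK x y x0) (iF x y x0)).
    rewrite (RintegralD (measurable_itvR _) (igc _ x y x0) (ihc _ x y x0)).
    rewrite (RintegralZl _ (measurable_itvR _) (ig x y x0)).
    rewrite (RintegralZl _ (measurable_itvR _) (ih x y x0)).
    by rewrite -ug// -vh// /E; ring.
  rewrite -(RintegralZl _ (measurable_itvR _) (iN x y x0)).
  apply: le_norm_locint => //; last first.
  - move=> t txy; have [ou ov] := osc t txy.
    rewrite (_ : _ - _ = (v y - v t) * g t + (u x - u t) * h t); last first.
      by rewrite /F; ring.
    rewrite /N mulrDr (le_trans (ler_normD _ _))// !normrM.
    by apply: lerD; apply: ler_wpM2r.
  - exact: locintZ.
  - apply: locintD => //; apply: (@eq_locint _ (fun t => -1 * F t)).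
      by move=> t _; rewrite mulN1r.
    exact: locintZ.
have chasles x y z : 0 < x -> x <= y -> y <= z -> E x z = E x y + E y z.
  by move=> x0 xy yz; rewrite /E (Rintegral_chasles iF x0 xy yz); ring.
have glob e : 0 < e -> `|E a b| <= e * \int[mu]_(t in `[a, b]) N t.
  move=> e0.
  have [d d0 Hd] := unif_continuous_segment b a0 e0 cu.
  have [d' d'0 Hd'] := unif_continuous_segment b a0 e0 cv.
  pose r := Num.min d d'; have r0 : 0 < r by rewrite lt_min d0.
  have small x y : a <= x -> x <= y -> y <= b -> y - x <= r ->
      `|E x y| <= e * \int[mu]_(t in `[x, y]) N t.
    move=> ax xy yb; rewrite le_min => /andP[yxd yxd'].
    apply: loc => //; first exact: lt_le_trans ax.
    move=> t /andP[xt ty]; split.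
      by rewrite distrC; apply: Hd => //; lra.
    by apply: Hd' => //; lra.
  have step n : forall x y, a <= x -> x <= y -> y <= b -> y - x <= n%:R * r ->
      `|E x y| <= e * \int[mu]_(t in `[x, y]) N t.
    elim: n => [|n IH] x y ax xy yb.
      by rewrite mul0r => h0; apply: small => //; rewrite (le_trans h0)// ltW.
    have [yxr _|ryx] := leP (y - x) r; first exact: small.
    rewrite -natr1 mulrDl mul1r => yxn.
    have x0 := lt_le_trans a0 ax.
    have xz : x <= x + r by rewrite lerDl ltW.
    have zy : x + r <= y by lra.
    rewrite (chasles x (x + r))// (Rintegral_chasles iN x0 xz zy) mulrDr.
    apply: le_trans (ler_normD _ _) _; apply: lerD.
      by apply: small => //; lra.
    by apply: IH => //; lra.
  have [n nr] : exists n, (b - a) / r <= n%:R.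
    by exists (Num.truncn ((b - a) / r)).+1; apply/ltW/truncnS_gt.
  by apply: (step n) => //; rewrite -ler_pdivrMr.
(* The bound by an arbitrary multiple of a fixed integral forces E to vanish. *)
suff /eqP : E a b = 0 by rewrite subr_eq0 => /eqP.
apply/eqP; rewrite -normr_le0 leNgt; apply/negP => E0.
set I := \int[mu]_(t in _) _ in glob.
have I0 : 0 <= I by apply: Rintegral_ge0 => t _; rewrite addr_ge0.
have := glob (`|E a b| / (2 * (I + 1))).
rewrite divr_gt0// ?mulr_gt0//; last by lra.
move=> /(_ isT); rewrite leNgt => /negP; apply.
rewrite -mulrA gtr_pMr// mulrC ltr_pdivrMr; lra.
Qed.

End PrimitiveProduct.

Section PrimitiveDifferentiation.
Context {R : realType}.
Notation mu := (@lebesgue_measure R).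
Implicit Types (u v g h : R -> R) (x y z t : R).

(** Lebesgue's differentiation theorem for g restricted to each of the segments
    [1/n, n], which exhaust the half-line. *)
Lemma primitive_ae_derive u g : primitive u g ->
  {ae mu, forall x, 0 < x -> is_derive x 1 u (g x)}.
Proof.
move=> [ig ug].
pose a n : R := n.+1%:R^-1; pose b n : R := n.+1%:R.
have a0 n : 0 < a n by rewrite invr_gt0.
pose f n := g \_ `[a n, b n].
have : \forall x \ae mu, forall n, lebesgue_pt (f n) x.
  apply: ae_foralln => n; apply: lebesgue_differentiation.
  by apply: integrable_locally (measurable_itvR _) _; exact: ig.
apply: filterS; first exact: (ae_filter_ringOfSetsType mu).
move=> x Hx x0.
have [n [anx xbn]] : exists n, a n < x /\ x < b n.
  pose n := Num.truncn (x + x^-1); exists n.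
  have xn : x + x^-1 < n.+1%:R by apply: truncnS_gt.
  have xV0 : 0 < x^-1 by rewrite invr_gt0.
  by split; [rewrite -[ltRHS]invrK ltf_pV2 ?posrE//|rewrite /b]; lra.
have ifn : mu.-integrable `[a n, b n] (EFin \o f n).
  rewrite /f -restrict_EFin; apply/integrable_restrict => //.
  by rewrite setIid; exact: ig.
have [dF F'] := @FTC1_lebesgue_pt _ (f n) (BLeft (a n)) x (b n) xbn ifn anx (Hx n).
have fx : f n x = g x by rewrite /f patchE mem_set //= in_itv/= !ltW.
rewrite -fx -F' derive1E.
have {dF F'} := derivableP dF.
set F := fun y => _.
move=> dF.
have dF' : is_derive x 1 (fun y => u (a n) + F y) ('D_1 F x).
  by rewrite -[X in is_derive _ _ _ X]add0r; exact: is_deriveD.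
apply: near_eq_is_derive dF'.
near=> y.
have any : a n < y by near: y; exact: lt_nbhsr.
have ybn : y < b n by near: y; exact: lt_nbhsl.
have -> : F y = \int[mu]_(t in `[a n, y]) g t.
  apply: eq_Rintegral => t; rewrite inE/= in_itv/= => /andP[at_ ty].
  by rewrite /f patchE mem_set//= in_itv/= at_ (le_trans ty)// ltW.
by rewrite -ug ?(ltW any)// addrC subrK.
Unshelve. all: by end_near. Qed.

End PrimitiveDifferentiation.

(** * Smooth bump functions *)

Section PointwiseDerivatives.
Context {R : realType}.
Implicit Types (f g : R -> R) (x a b : R).

Lemma derive_add f g x a b : is_derive x 1 f a -> is_derive x 1 g b ->
  is_derive x 1 (fun t => f t + g t) (a + b).
Proof. by move=> df dg; exact: is_deriveD. Qed.

Lemma derive_mul f g x a b : is_derive x 1 f a -> is_derive x 1 g b ->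
  is_derive x 1 (fun t => f t * g t) (a * g x + f x * b).
Proof.
move=> df dg; have := is_deriveM df dg; rewrite addrC /GRing.scale/= (mulrC (g x)).
exact.
Qed.

Lemma derive_scale f x a c : is_derive x 1 f a ->
  is_derive x 1 (fun t => c * f t) (c * a).
Proof. by move=> df; exact: is_deriveZ. Qed.

Lemma is_derive_continuous f x a : is_derive x 1 f a -> {for x, continuous f}.
Proof.
by case=> df _; apply: differentiable_continuous; apply/derivable1_diffP.
Qed.

Lemma is_derive1E f x a : is_derive x 1 f a -> derive1 f x = a.
Proof. by case=> _ <-; rewrite derive1E. Qed.

End PointwiseDerivatives.

Section Smooth.
Context {R : realType}.
Implicit Types (f g : R -> R) (P Q : {poly R}) (x t c s k : R).

(** Smoothness by coinduction: a class of functions that is stable under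
    derivation consists of smooth functions. The closure properties below each
    exhibit such a class. *)
Lemma smooth_coind (C : (R -> R) -> Prop) :
  (forall f, C f -> (forall x, derivable f x 1) /\ C (derive1 f)) ->
  forall f, C f -> smooth f.
Proof.
move=> CC f Cf n; have : C (derive1n n f) by elim: n => //= n IH; case: (CC _ IH).
by case/CC.
Qed.

Lemma smooth_derive f g : (forall x, is_derive x 1 f (g x)) -> smooth g ->
  smooth f.
Proof.
move=> dfg sg [|n]; first by move=> x; case: (dfg x).
rewrite derive1Sn (_ : derive1 f = g); first exact: sg.
by apply/funext => x; exact: is_derive1E.
Qed.

Lemma smoothD f g : smooth f -> smooth g -> smooth (fun t => f t + g t).
Proof.
move=> sf sg; apply: (@smooth_coind (fun h => exists f g,
  [/\ smooth f, smooth g & h = fun t => f t + g t])); last by exists f, g.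
move=> _ [{}f [{}g [{}sf {}sg ->]]].
have D x : is_derive x 1 (fun t => f t + g t) (derive1 f x + derive1 g x).
  by apply: derive_add; rewrite derive1E; apply: derivableP;
    [exact: (sf 0)|exact: (sg 0)].
split=> [x|]; first by case: (D x).
exists (derive1 f), (derive1 g); split.
- by move=> n; rewrite -derive1Sn; exact: sf.
- by move=> n; rewrite -derive1Sn; exact: sg.
- by apply/funext => x; exact: is_derive1E.
Qed.

Lemma smooth_affine f k s c : smooth f -> smooth (fun t => k * f (s * t + c)).
Proof.
move=> sf; apply: (@smooth_coind (fun h => exists f k,
  smooth f /\ h = fun t => k * f (s * t + c))); last by exists f, k.
move=> _ [{}f [{}k [{}sf ->]]].
have D x : is_derive x 1 (fun t => k * f (s * t + c)) (k * s * derive1 f (s * x + c)).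
  rewrite -mulrA; apply: derive_scale; rewrite mulrC.
  apply: (@is_derive1_comp _ f (fun t => s * t + c)).
    by rewrite derive1E; apply: derivableP; exact: (sf 0).
  rewrite -[X in is_derive _ _ _ X]addr0; apply: derive_add.
  by rewrite -[X in is_derive _ _ _ X]mulr1; apply: derive_scale.
split=> [x|]; first by case: (D x).
exists (derive1 f), (k * s); split.
- by move=> n; rewrite -derive1Sn; exact: sf.
- by apply/funext => x; exact: is_derive1E.
Qed.

(** The class generated by the Leibniz rule from a product. *)
Inductive sum_of_products : (R -> R) -> Prop :=
| product_mem f g : smooth f -> smooth g ->
    sum_of_products (fun t => f t * g t)
| sum_mem f g : sum_of_products f -> sum_of_products g ->
    sum_of_products (fun t => f t + g t).

Lemma smoothM f g : smooth f -> smooth g -> smooth (fun t => f t * g t).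
Proof.
move=> sf sg; apply: (@smooth_coind sum_of_products); last exact: product_mem.
move=> h Ch; elim: h / Ch => [{}f {}g {}sf {}sg|{sf sg} {}f {}g _ [df Cf] _ [dg Cg]].
  have D x : is_derive x 1 (fun t => f t * g t) (derive1 f x * g x + f x * derive1 g x).
    by apply: derive_mul; rewrite derive1E; apply: derivableP;
      [exact: (sf 0)|exact: (sg 0)].
  split=> [x|]; first by case: (D x).
  rewrite (_ : derive1 _ = fun t => derive1 f t * g t + f t * derive1 g t); last first.
    by apply/funext => x; exact: is_derive1E.
  have sf' : smooth (derive1 f) by move=> n; rewrite -derive1Sn; exact: sf.
  have sg' : smooth (derive1 g) by move=> n; rewrite -derive1Sn; exact: sg.
  by apply: sum_mem; apply: product_mem.
have D x : is_derive x 1 (fun t => f t + g t) (derive1 f x + derive1 g x).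
  by apply: derive_add; rewrite derive1E; apply: derivableP;
    [exact: df|exact: dg].
split=> [x|]; first by case: (D x).
rewrite (_ : derive1 _ = fun t => derive1 f t + derive1 g t); first exact: sum_mem.
by apply/funext => x; exact: is_derive1E.
Qed.

(** A family stable under derivation, around the classical flat function
    exp(-1/t), which is the case P = 1. *)
Definition flat P t := if 0 < t then P.[t^-1] * expR (- t^-1) else 0.

Lemma expn_expR_bounded n x : 0 <= x -> x ^+ n * expR (- x) <= n`!%:R.
Proof.
move=> x0; rewrite expRN ler_pdivrMr ?expR_gt0//.
case: n => [|n]; first by rewrite expr0 mul1r -expR0 ler_expR.
have := expR_ge1Dxn n x0; rewrite -ler_pdivrMl ?ltr0n ?fact_gt0//.
by apply: le_trans; rewrite mulrC lerDr.
Qed.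

Lemma poly_expR_bounded P :
  exists2 C, 0 < C & forall x, 0 <= x -> `|P.[x]| * expR (- x) <= C.
Proof.
exists (1 + \sum_(i < size P) `|P`_i| * i`!%:R) => [|x x0].
  by rewrite ltr_pwDl// sumr_ge0// => i _; rewrite mulr_ge0.
rewrite horner_coef (@le_trans _ _ (\sum_(i < size P) `|P`_i| * i`!%:R))//; last first.
  by rewrite lerDr.
apply: (@le_trans _ _ ((\sum_(i < size P) `|P`_i * x ^+ i|) * expR (- x))).
  by rewrite ler_wpM2r ?expR_ge0// ler_norm_sum.
rewrite mulr_suml; apply: ler_sum => i _.
rewrite normrM -mulrA ler_wpM2l// ger0_norm ?exprn_ge0//.
exact: expn_expR_bounded.
Qed.

(** The exponential absorbs the polynomial 'X^2 * P; the quadratic bound makes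
    every difference quotient at 0 tend to 0. *)
Lemma flat_quadratic P : exists2 C, 0 < C & forall t, `|flat P t| <= C * t ^+ 2.
Proof.
have [C C0 HC] := poly_expR_bounded ('X^2 * P).
exists C => // t; rewrite /flat; case: ltP => t0; last first.
  by rewrite normr0 mulr_ge0 ?sqr_ge0 ?ltW.
have tV : 0 <= t^-1 by rewrite invr_ge0 ltW.
have := HC _ tV; rewrite hornerM hornerXn normrM (ger0_norm (exprn_ge0 2 tV)).
rewrite -mulrA exprVn ler_pdivrMl ?exprn_gt0// => PC.
by rewrite normrM (ger0_norm (expR_ge0 _)) (mulrC C).
Qed.

Lemma flat_derive P x :
  is_derive x 1 (flat P) (flat ('X^2 * (P - P^`())) x).
Proof.
have [x0|x0|->] := ltgtP x 0.
- rewrite {2}/flat ltNge (ltW x0)/=.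
  apply: (@near_eq_is_derive _ _ _ (fun=> 0)).
  near=> t; rewrite /flat ltNge ifF//; apply/negbF/ltW.
  by near: t; exact: lt_nbhsl.
- rewrite {2}/flat x0.
  have dV : is_derive x 1 (fun t => t^-1) (- x ^- 2).
    have := @is_deriveV _ id x 1 1 (lt0r_neq0 x0) _.
    by rewrite /GRing.scale/= mulr1; apply.
  have D : is_derive x 1 (fun t => P.[t^-1] * expR (- t^-1))
     ((P^`().[x^-1] * (- x ^- 2)) * expR (- x^-1) +
      P.[x^-1] * (expR (- x^-1) * (x ^- 2))).
    have dNV : is_derive x 1 (fun t => - t^-1) (x ^- 2).
      by rewrite -[X in is_derive _ _ _ X]opprK; exact: is_deriveN.
    exact: derive_mul.
  have -> : ('X^2 * (P - P^`())).[x^-1] * expR (- x^-1) =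
     (P^`().[x^-1] * (- x ^- 2)) * expR (- x^-1) +
      P.[x^-1] * (expR (- x^-1) * (x ^- 2)).
    rewrite -exprVn hornerM hornerXn hornerD hornerN.
    by move: (P.[_]) (P^`().[_]) (expR _) (x^-1 ^+ 2) => ? ? ? ?; ring.
  apply: near_eq_is_derive D.
  near=> t; rewrite /flat ifT//; near: t; exact: lt_nbhsr.
- rewrite {2}/flat ltxx.
  have [C C0 HC] := flat_quadratic P.
  have cv : h^-1 *: (flat P (h *: 1 + 0) - flat P 0) @[h --> (0 : R)^'] --> (0 : R).
    apply/cvgrPdist_le => e e0; near=> h.
    rewrite sub0r normrN addr0 /GRing.scale/= mulr1 {2}/flat ltxx subr0.
    rewrite normrM normfV ler_pdivrMl ?normr_gt0; last first.
      by near: h; exact: nbhs_dnbhs_neq.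
    apply: le_trans (HC h) _.
    rewrite -real_normK ?num_real// expr2 mulrCA ler_wpM2l//.
    rewrite -ler_pdivlMl// mulrC.
    by near: h; apply: dnbhs0_le; rewrite divr_gt0.
  apply: DeriveDef; first by apply/cvg_ex; exists 0.
  exact/cvg_lim.
Unshelve. all: by end_near. Qed.

Lemma smooth_flat P : smooth (flat P).
Proof.
apply: (@smooth_coind (fun f => exists P, f = flat P)); last by exists P.
move=> _ [{}P ->]; split=> [x|]; first by case: (flat_derive P x).
exists ('X^2 * (P - P^`())); apply/funext => x.
by apply: is_derive1E; exact: flat_derive.
Qed.

End Smooth.

Section Bump.
Context {R : realType}.
Notation mu := (@lebesgue_measure R).
Implicit Types (x t e : R).

Lemma MVT_derive (f df : R -> R) x y : x < y ->
  (forall t, is_derive t 1 f (df t)) ->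
  exists2 c, x < c < y & f y - f x = df c * (y - x).
Proof.
move=> xy Df.
have [|c cxy E] := @MVT _ f df x y xy (fun t _ => Df t).
  by apply: continuous_subspaceT => t; exact: is_derive_continuous (Df t).
by exists c => //; move: cxy; rewrite in_itv.
Qed.

Definition bump e t : R := flat 1 t * flat 1 (e - t).

Lemma smooth_bump e : smooth (bump e).
Proof.
apply: smoothM; first exact: smooth_flat.
rewrite (_ : (fun t => _) = fun t => 1 * flat 1 (-1 * t + e)).
  by apply: smooth_affine; exact: smooth_flat.
by apply/funext => t; rewrite mul1r mulN1r addrC.
Qed.

Lemma bump_gt0 e t : 0 < t < e -> 0 < bump e t.
Proof.
move=> /andP[t0 te]; rewrite /bump /flat t0 subr_gt0 te !hornerE.
by rewrite !mulr_gt0 ?expR_gt0.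
Qed.

Lemma bump_out e t : ~~ (0 < t < e) -> bump e t = 0.
Proof.
rewrite negb_and -!leNgt /bump /flat subr_gt0 => /orP[t0|et].
  by rewrite ltNge t0 mul0r.
by rewrite [t < e]ltNge et mulr0.
Qed.

Lemma bump_ge0 e t : 0 <= bump e t.
Proof.
have [/bump_gt0/ltW//|/bump_out->//] := boolP (0 < t < e).
Qed.

Lemma smooth_continuous (f : R -> R) : smooth f -> continuous f.
Proof.
move=> sf t; apply: differentiable_continuous; apply/derivable1_diffP.
exact: (sf 0).
Qed.

(** A smooth step of width e. A difference of two translates of B is a test
    function, whose derivative is a difference of two bumps of equal mass. *)
Lemma bump_antiderivative e : 0 < e -> exists B : R -> R,
  [/\ smooth B, forall t, is_derive t 1 B (bump e t),
      forall t, t <= 0 -> B t = 0 &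
      exists2 I, 0 < I & forall t, e <= t -> B t = I].
Proof.
move=> e0; have cb : continuous (bump e) by apply: smooth_continuous; exact: smooth_bump.
pose B x := \int[mu]_(t in [set` Interval (BLeft (-1 : R)) (BRight x)]) bump e t.
have B0 t : t <= 0 -> B t = 0.
  move=> t0; rewrite /B (_ : \int[mu]_(x in _) _ = \int[mu]_(x in `[-1, t]) 0).
    by rewrite Rintegral_cst// mul0r.
  apply: eq_Rintegral => x; rewrite inE/= in_itv/= => /andP[_ xt].
  by apply: bump_out; rewrite ltNge (le_trans xt t0).
(* The fundamental theorem needs t > -1; to the left of 0, B is locally 0. *)
have dB t : is_derive t 1 B (bump e t).
  have [t0|t0] := ltP t 0.
    rewrite bump_out ?(ltNge 0) ?(ltW t0)//.
    apply: (@near_eq_is_derive _ _ _ (fun=> 0)).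
    near=> x; rewrite B0//; apply/ltW; near: x; exact: lt_nbhsl.
  have tN1 : -1 < t by lra.
  have ib : mu.-integrable `[-1, t + 1] (EFin \o bump e).
    apply: continuous_compact_integrable; first exact: segment_compact.
    exact: continuous_subspaceT.
  have t1 : t < t + 1 by rewrite ltrDl.
  have [dB dBE] := continuous_FTC1_closed t1 ib tN1 (cb t).
  by apply: (DeriveDef dB); rewrite -derive1E dBE.
exists B; split=> //.
  by apply: smooth_derive dB _; exact: smooth_bump.
exists (B e) => [|t].
  have [c ce] := MVT_derive e0 dB.
  by rewrite (B0 0)// !subr0 => ->; rewrite mulr_gt0// bump_gt0.
rewrite le_eqVlt => /predU1P[->//|et].
have [c /andP[ec _]] := MVT_derive et dB.
rewrite bump_out; last by rewrite negb_and -!leNgt (ltW ec) orbT.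
by rewrite mul0r => /eqP; rewrite subr_eq0 => /eqP.
Unshelve. all: by end_near. Qed.

End Bump.

(** * Weak derivatives and the lemma of du Bois-Reymond *)

Section WeakDerivative.
Context {R : realType}.
Notation mu := (@lebesgue_measure R).
Implicit Types (u g h phi : R -> R) (a b x y t e : R).

Definition real_test phi := smooth phi /\
  exists a b : R, 0 < a /\ forall r, ~~ (a <= r <= b) -> phi r = 0.

Definition weak_derivative u g := forall phi, real_test phi ->
  \int[mu]_(r in `]0, +oo[) (u r * derive1 phi r) =
  - \int[mu]_(r in `]0, +oo[) (g r * phi r).

Lemma patch_support h a b : 0 < a -> (forall r, ~~ (a <= r <= b) -> h r = 0) ->
  h \_ `]0, +oo[ = h \_ `[a, b].
Proof.
move=> a0 h0; apply/funext => r; rewrite !patchE.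
have [rab|rab] := boolP (a <= r <= b).
  have r0 : 0 < r by case/andP : rab => /(lt_le_trans a0).
  by rewrite !mem_set//= in_itv/= ?r0.
by rewrite h0// !if_same.
Qed.

Lemma Rintegral_support h a b : 0 < a ->
  (forall r, ~~ (a <= r <= b) -> h r = 0) ->
  \int[mu]_(r in `]0, +oo[) h r = \int[mu]_(r in `[a, b]) h r.
Proof.
move=> a0 h0; rewrite Rintegral_mkcond [RHS]Rintegral_mkcond.
by rewrite (patch_support a0 h0).
Qed.

Lemma integrable_support h a b : 0 < a -> locint h ->
  (forall r, ~~ (a <= r <= b) -> h r = 0) ->
  mu.-integrable `]0, +oo[ (EFin \o h).
Proof.
move=> a0 ih h0; apply/integrable_mkcond => //.
rewrite restrict_EFin (patch_support a0 h0) -restrict_EFin.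
exact: (iffLR (integrable_mkcond _ (measurable_itvR _)) (ih a b a0)).
Qed.

Lemma real_test_derive phi a b : smooth phi ->
  (forall r, ~~ (a <= r <= b) -> phi r = 0) ->
  forall r, ~~ (a <= r <= b) -> derive1 phi r = 0.
Proof.
move=> sphi phi0 r; rewrite negb_and -!ltNge => rab.
apply: (@is_derive1E _ _ _ 0); apply: (@near_eq_is_derive _ _ _ (fun=> 0)).
case/orP: rab => rab; near=> t; rewrite phi0// negb_and -!ltNge.
  by rewrite (_ : t < a)//; near: t; exact: lt_nbhsl.
by rewrite (_ : b < t) ?orbT//; near: t; exact: lt_nbhsr.
Unshelve. all: by end_near. Qed.

Lemma smooth_is_derive phi t : smooth phi -> is_derive t 1 phi (derive1 phi t).
Proof. by move=> s; rewrite derive1E; apply: derivableP; exact: (s 0). Qed.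

Lemma smooth_derive1 phi : smooth phi -> smooth (derive1 phi).
Proof. by move=> s n; rewrite -derive1Sn; exact: s. Qed.

Lemma smooth_primitive phi : smooth phi -> primitive phi (derive1 phi).
Proof.
move=> s; apply: derive_primitive => t _; first exact: smooth_is_derive.
by apply: smooth_continuous; exact: smooth_derive1.
Qed.

(** Integration by parts is the product rule for u phi, on a segment slightly
    larger than the support of phi. *)
Lemma primitive_weak_derivative u g : primitive u g -> weak_derivative u g.
Proof.
move=> pu phi [sphi [a [b [a0 phi0]]]].
have [iguu ug] := pu.
pose a' := a / 2; pose b' := Num.max a b + 1.
have a'0 : 0 < a' by rewrite divr_gt0.
have bb' : b < b' by rewrite /b' ltr_pwDr// le_max lexx orbT.
have ab' : a < b' by rewrite /b' ltr_pwDr// le_max lexx.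
have a'a : a' < a by rewrite /a'; lra.
have out r : ~~ (a' <= r <= b') -> ~~ (a <= r <= b).
  by apply: contra => /andP[? ?]; apply/andP; split; lra.
have dphi0 := real_test_derive sphi phi0.
rewrite (@Rintegral_support _ a' b')//; last first.
  by move=> r /out rab; rewrite dphi0// mulr0.
rewrite (@Rintegral_support (fun r => g r * phi r) a' b')//; last first.
  by move=> r /out rab; rewrite phi0// mulr0.
have [ip pp] := primitiveM pu (smooth_primitive sphi).
have := pp a' b' a'0; rewrite !phi0 ?mulr0 ?subr0; last 2 first.
- by rewrite negb_and -!ltNge a'a.
- by rewrite negb_and -!ltNge bb' orbT.
move=> /(_ ltac:(lra)).
have cphi t : 0 < t -> {for t, continuous phi}.
  by move=> _; exact: smooth_continuous.
have cphi' t : 0 < t -> {for t, continuous (derive1 phi)}.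
  by move=> _; apply: smooth_continuous; exact: smooth_derive1.
have i1 : locint (fun t => g t * phi t).
  by apply: (@eq_locint _ (fun t => phi t * g t));
    [move=> t _; rewrite mulrC|exact: locintM].
have i2 : locint (fun t => u t * derive1 phi t).
  by apply: locintM; [move=> t; exact: primitive_continuous pu|exact: continuous_locint].
rewrite (RintegralD (measurable_itvR _) (i1 a' b' a'0) (i2 a' b' a'0)).
by move/esym/eqP; rewrite addrC addr_eq0 => /eqP.
Qed.

Lemma exists_primitive g : locint g -> exists u, primitive u g.
Proof.
move=> ig; exists (fun x => if 1 <= x then \int[mu]_(t in `[1, x]) g t
                   else - \int[mu]_(t in `[x, 1]) g t).
split=> // x y x0 xy; have y0 := lt_le_trans x0 xy.
have [y1|y1] := leP 1 y; have [x1|x1] := leP 1 x.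
- by rewrite (Rintegral_chasles ig ltr01 x1 xy); ring.
- by rewrite (Rintegral_chasles ig x0 (ltW x1) y1); ring.
- by have := le_lt_trans (le_trans x1 xy) y1; rewrite ltxx.
- by rewrite (Rintegral_chasles ig x0 xy (ltW y1)); ring.
Qed.

Lemma derive_shift (f f' : R -> R) c t : (forall t, is_derive t 1 f (f' t)) ->
  is_derive t 1 (fun t => f (t - c)) (f' (t - c)).
Proof.
move=> df; rewrite -[f' _]mulr1.
apply: (@is_derive1_comp _ f (fun t => t - c)); rewrite -[X in is_derive _ _ _ X]addr0.
exact: derive_add.
Qed.

(** Testing against B(t - a) - B(t - b) shows that z has the same weighted mean
    over [a, a + e] and over [b, b + e]; by continuity these means are as close
    as wanted to z a and z b. *)
Lemma weak_derivative0_constant z :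
  (forall t, 0 < t -> {for t, continuous z}) ->
  weak_derivative z (fun=> 0) -> forall a b, 0 < a -> a < b -> z a = z b.
Proof.
move=> cz wz a b a0 ab; apply/eqP; rewrite -subr_eq0 -normr_le0.
apply/ler_addgt0Pr => eta eta0; rewrite add0r.
have eta20 : 0 < eta / 2 by rewrite divr_gt0.
have [d d0 Hd] := unif_continuous_segment (b + 1) a0 eta20 cz.
pose e := Num.min d 1; have e0 : 0 < e by rewrite lt_min d0 ltr01.
have [ed e1] : e <= d /\ e <= 1 by rewrite /e !ge_min !lexx orbT.
have [B [sB dB B0 [I I0 BI]]] := bump_antiderivative e0.
have cbump : continuous (bump e) by apply: smooth_continuous; exact: smooth_bump.
have cshift c t : {for t, continuous (fun t => bump e (t - c))}.
  apply: (@continuous_comp _ _ _ (fun t => t - c) (bump e)); last exact: cbump.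
  by apply: cvgB; [exact: cvg_id|exact: cvg_cst].
have ibump c : locint (fun t => bump e (t - c)) by apply: continuous_locint.
have izbump c : locint (fun t => z t * bump e (t - c)) by exact: locintM.
have weight c : a <= c <= b -> \int[mu]_(t in `[a, b + e]) bump e (t - c) = I.
  move=> /andP[ac cb].
  have [_ pB] : primitive (fun t => B (t - c)) (fun t => bump e (t - c)).
    by apply: derive_primitive => t _; [exact: derive_shift|exact: cshift].
  by rewrite -pB ?(B0 (a - c)) ?BI ?subr0//; lra.
have mean c : a <= c <= b ->
    `|\int[mu]_(t in `[a, b + e]) (z t * bump e (t - c)) - z c * I|
      <= eta / 2 * I.
  move=> cab; rewrite -(weight c cab).
  rewrite -(RintegralZl _ (measurable_itvR _) (ibump c _ _ a0)).
  rewrite -(RintegralB (measurable_itvR _) (izbump c _ _ a0) (locintZ _ (ibump c) _ a0)).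
  rewrite -(RintegralZl _ (measurable_itvR _) (ibump c _ _ a0)).
  apply: le_norm_locint => //; last 1 first.
  - move=> t /andP[at_ tb]; rewrite -mulrBl normrM (ger0_norm (bump_ge0 _ _)).
    have [|out] := boolP (0 < t - c < e); last by rewrite bump_out// !mulr0.
    move=> /andP[tc0 tce]; apply: ler_wpM2r; first exact: bump_ge0.
    by apply: Hd; case/andP: cab => *; lra.
  - apply: (@eq_locint _ (fun t => z t * bump e (t - c) + (- z c) * bump e (t - c))).
      by move=> t _; rewrite mulNr.
    by apply: locintD => //; exact: locintZ.
  - exact: locintZ.
pose phi t := B (t - a) + (-1) * B (t - b).
have dphi t : is_derive t 1 phi (bump e (t - a) + (-1) * bump e (t - b)).
  by apply: derive_add; [|apply: derive_scale]; exact: derive_shift.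
have sphi : smooth phi.
  apply: smooth_derive dphi _; apply: smoothD.
    have := @smooth_affine _ (bump e) 1 1 (- a) (@smooth_bump _ e).
    by congr smooth; apply/funext => t; rewrite !mul1r.
  have := @smooth_affine _ (bump e) (-1) 1 (- b) (@smooth_bump _ e).
  by congr smooth; apply/funext => t; rewrite mul1r.
have phi0 r : ~~ (a <= r <= b + e) -> phi r = 0.
  rewrite negb_and -!ltNge /phi => /orP[ra|br].
    by rewrite !B0 ?mulr0 ?addr0//; lra.
  by rewrite !BI ?mulN1r ?subrr//; lra.
have := wz phi; rewrite (@Rintegral_support _ a (b + e))//; last first.
  by move=> r rab; rewrite (real_test_derive sphi phi0)// mulr0.
rewrite (_ : \int[mu]_(r in `]0, +oo[) (0 * phi r) = 0); last first.
  by under eq_Rintegral do rewrite mul0r; rewrite Rintegral_cst// mul0r.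
rewrite oppr0 => /(_ (conj sphi (ex_intro _ a (ex_intro _ (b + e) (conj a0 phi0))))).
rewrite (_ : \int[mu]_(r in _) _ =
  \int[mu]_(t in `[a, b + e]) (z t * bump e (t - a)) -
  \int[mu]_(t in `[a, b + e]) (z t * bump e (t - b))); last first.
  rewrite -(RintegralB (measurable_itvR _) (izbump a _ _ a0) (izbump b _ _ a0)).
  by apply: eq_Rintegral => t _; rewrite (is_derive1E (dphi t)); ring.
move/eqP; rewrite subr_eq0 => /eqP E.
have := mean a; rewrite lexx (ltW ab) E => /(_ isT) ma.
have := mean b; rewrite lexx (ltW ab) => /(_ isT) mb.
set J := \int[mu]_(t in _) _ in ma mb.
suff : `|z a - z b| * I <= eta * I by rewrite ler_pM2r.
rewrite -{1}(gtr0_norm I0) -normrM.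
rewrite (_ : (z a - z b) * I = (J - z b * I) - (J - z a * I)); last by ring.
rewrite [eta in leRHS]splitr mulrDl.
exact: le_trans (ler_normB _ _) (lerD mb ma).
Qed.

(** Subtracting any primitive of g from u leaves a continuous function with zero
    weak derivative. *)
Lemma weak_derivative_primitive u g :
  (forall t, 0 < t -> {for t, continuous u}) -> locint g ->
  weak_derivative u g -> primitive u g.
Proof.
move=> cu ig wu; have [U pU] := exists_primitive ig.
have cU t : 0 < t -> {for t, continuous U} by exact: primitive_continuous pU.
pose z t := u t + (-1) * U t.
have cz t : 0 < t -> {for t, continuous z}.
  move=> t0; apply: cvgD; first exact: cu.
  by apply: cvgM; [exact: cvg_cst|exact: cU].
have wz : weak_derivative z (fun=> 0).
  move=> phi tphi; have [sphi [a [b [a0 phi0]]]] := tphi.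
  have out := real_test_derive sphi phi0.
  have cphi' t : 0 < t -> {for t, continuous (derive1 phi)}.
    by move=> _; apply: smooth_continuous; exact: smooth_derive1.
  have int (f : R -> R) : (forall t, 0 < t -> {for t, continuous f}) ->
      mu.-integrable `]0, +oo[ (EFin \o (fun t => f t * derive1 phi t)).
    move=> cf; apply: (@integrable_support _ a b) => //.
      by apply: locintM => //; exact: continuous_locint.
    by move=> r /out ->; rewrite mulr0.
  under [in RHS]eq_Rintegral do rewrite mul0r.
  rewrite Rintegral_cst// mul0r oppr0.
  transitivity (\int[mu]_(r in `]0, +oo[) (u r * derive1 phi r - U r * derive1 phi r)).
    by apply: eq_Rintegral => t _; rewrite /z; ring.
  rewrite (RintegralB (measurable_itvR _) (int _ cu) (int _ cU)).
  by rewrite wu// (primitive_weak_derivative pU)// subrr.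
have zE := weak_derivative0_constant cz wz.
have z1 t : 0 < t -> z t = z 1.
  by move=> t0; have [t1|t1|->//] := ltgtP t 1; [exact: zE|exact/esym/zE].
split=> // x y x0 xy; have [_ UE] := pU; rewrite -UE//.
have := z1 x x0; have := z1 y (lt_le_trans x0 xy); rewrite /z => zy zx.
lra.
Qed.

End WeakDerivative.

(** * Square integrable functions on the half-line *)

Section SquareIntegrable.
Context {R : realType}.
Notation mu := (@lebesgue_measure R).
Implicit Types (f g u w : R -> R) (a b x y t e c : R).

(** Phrased with integrable, so that sums and dominated functions need no separate
    finiteness argument. *)
Definition sqint f := measurable_fun half_line f /\
  mu.-integrable half_line (EFin \o (fun t => f t ^+ 2)).

Lemma half_lineP t : half_line t <-> 0 < t.
Proof. by rewrite /half_line /= in_itv/= andbT. Qed.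

Lemma continuous_measurable_half f :
  (forall t, 0 < t -> {for t, continuous f}) -> measurable_fun half_line f.
Proof.
move=> cf; apply: open_continuous_measurable_fun; first exact: interval_open.
by move=> t; rewrite inE => /half_lineP; exact: cf.
Qed.

Lemma integrable_half_dominated f g : measurable_fun half_line f ->
  mu.-integrable half_line (EFin \o g) ->
  (forall t, 0 < t -> `|f t| <= g t) -> mu.-integrable half_line (EFin \o f).
Proof.
move=> mf ig fg; apply: (le_integrable measurable_half_line _ _ ig).
  exact/measurable_EFinP.
move=> t /half_lineP t0 /=; rewrite lee_fin (le_trans (fg t t0))//.
exact: ler_norm.
Qed.

Lemma sqint_dominated f g : measurable_fun half_line f ->
  mu.-integrable half_line (EFin \o g) ->
  (forall t, 0 < t -> f t ^+ 2 <= g t) -> sqint f.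
Proof.
move=> mf ig fg; split=> //.
apply: integrable_half_dominated ig _; first exact: measurable_funX.
by move=> t t0; rewrite ger0_norm ?sqr_ge0//; exact: fg.
Qed.

Lemma sqintZ c f : sqint f -> sqint (fun t => c * f t).
Proof.
move=> [mf sf]; apply: (@sqint_dominated _ (fun t => c ^+ 2 * f t ^+ 2)).
- by apply: measurable_funM.
- exact: (integrableZl measurable_half_line (c ^+ 2) sf).
- by move=> t _; rewrite exprMn.
Qed.

Lemma sqintD f g : sqint f -> sqint g -> sqint (fun t => f t + g t).
Proof.
move=> [mf sf] [mg sg].
apply: (@sqint_dominated _ (fun t => 2 * f t ^+ 2 + 2 * g t ^+ 2)).
- exact: measurable_funD.
- exact: (integrableD measurable_half_line
    (integrableZl measurable_half_line 2 sf)
    (integrableZl measurable_half_line 2 sg)).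
- by move=> t _; have := sqr_ge0 (f t - g t); nra.
Qed.

Lemma integrable_half_segment f x y : 0 < x ->
  mu.-integrable half_line (EFin \o f) -> mu.-integrable `[x, y] (EFin \o f).
Proof.
move=> x0; apply: integrableS; [exact: measurable_half_line|exact: measurable_itvR|].
by move=> t /= txy; apply/half_lineP; exact: segment_pos txy.
Qed.

Lemma sqint_locint_sqr f : sqint f -> locint (fun t => f t ^+ 2).
Proof. by move=> [_ sf] x y x0; exact: integrable_half_segment. Qed.

Lemma sqint_locint f : sqint f -> locint f.
Proof.
move=> sf x y x0.
have i1 : locint (fun t => 1 + f t ^+ 2).
  apply: locintD; last exact: sqint_locint_sqr.
  by apply: continuous_locint => t _; exact: cst_continuous.
apply: (le_integrable (measurable_itvR _) _ _ (i1 x y x0)).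
  apply/measurable_EFinP; apply: (measurable_funS measurable_half_line); last exact: sf.1.
  by move=> t /= txy; apply/half_lineP; exact: segment_pos txy.
move=> t _ /=; rewrite lee_fin (le_trans _ (ler_norm _))//.
have := sqr_ge0 (`|f t| - 1); rewrite -(real_normK (num_real (f t))); nra.
Qed.

Lemma L2P (f : R -> R[i]) : L2 f <-> sqint (reF f) /\ sqint (imF f).
Proof.
have E t : normc (f t) ^+ 2 = reF f t ^+ 2 + imF f t ^+ 2.
  rewrite /reF /imF; case: (f t) => p q /=.
  by rewrite sqr_sqrtr// addr_ge0 ?sqr_ge0.
split=> [[mr mi fin]|[[mr sr] [mi si]]].
  have mn : measurable_fun half_line (fun t => reF f t ^+ 2 + imF f t ^+ 2).
    by apply: measurable_funD; apply: measurable_funX.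
  have ie : mu.-integrable half_line
      (EFin \o (fun t => reF f t ^+ 2 + imF f t ^+ 2)).
    apply/integrableP; split; first exact/measurable_EFinP.
    move: fin; congr (_ < _)%E; apply: eq_integral => t _ /=; congr EFin.
    by rewrite E ger0_norm// addr_ge0 ?sqr_ge0.
  by split; apply: (sqint_dominated _ ie) => // t _; rewrite ?lerDl ?lerDr sqr_ge0.
split=> //.
have := integrableD measurable_half_line sr si.
move=> /(integrable_lty measurable_half_line).
by congr (_ < _)%E; apply: eq_integral => t _ /=; rewrite E.
Qed.

End SquareIntegrable.

Section Energy.
Context {R : realType}.
Notation mu := (@lebesgue_measure R).
Implicit Types (f g u w : R -> R) (a b x y t e c C : R).

(** Monotone convergence along the segments [c/(n+2), 1]. *)
Lemma integral_near0_le f C c : measurable_fun half_line f ->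
  (forall t, 0 < t -> 0 <= f t) -> 0 < c ->
  (forall e, 0 < e < c -> (\int[mu]_(t in `[e, 1%R]) (f t)%:E <= C%:E)%E) ->
  (\int[mu]_(t in `]0%R, 1%R]) (f t)%:E <= C%:E)%E.
Proof.
move=> mf f0 c0 fC.
pose F n : set (measurableTypeR R) := `[c / n.+2%:R, 1]%classic.
have F0 n : F n `<=` half_line.
  move=> t; rewrite /F /= => tF; apply/half_lineP.
  by apply: segment_pos tF; rewrite divr_gt0.
have cvF : (\int[mu]_(t in F i) (f t)%:E)%E @[i --> \oo] -->
    (\int[mu]_(t in \bigcup_i F i) (f t)%:E)%E.
  apply: ge0_nondecreasing_set_cvg_integral => //.
  - move=> n p np; apply/subsetPset => t; rewrite /F /= !in_itv/= => /andP[nt ->].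
    rewrite andbT (le_trans _ nt)// ler_pM2l// lef_pV2 ?posrE ?ltr0n//.
    by rewrite ler_nat.
  - by move=> n; exact: measurable_itvR.
  - move=> n; apply/measurable_EFinP; exact: measurable_funS mf.
  - by move=> n t /F0/half_lineP t0; rewrite lee_fin f0.
have -> : `]0%R, 1%R]%classic = \bigcup_i F i.
  apply/seteqP; split=> t /=; rewrite in_itv/=.
    move=> /andP[t0 t1]; exists (Num.truncn (c / t)) => //.
    rewrite /F /= in_itv/= t1 andbT ler_pdivrMr// mulrC -ler_pdivrMr//.
    apply/ltW/(lt_trans (truncnS_gt _)).
    by rewrite ltr_nat.
  move=> [n _ tF]; have /half_lineP -> := F0 n t tF.
  by move: tF; rewrite /F /= in_itv/= => /andP[].
rewrite -(cvg_lim _ cvF)//; apply: lime_le; first by apply/cvg_ex; eexists; exact: cvF.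
near=> n; apply: fC; rewrite divr_gt0//= ltr_pdivrMr// ltr_pMr//.
by rewrite ltr1n.
Unshelve. all: by end_near. Qed.

Lemma integrable_half_split f : measurable_fun half_line f ->
  (forall t, 0 < t -> 0 <= f t) ->
  (\int[mu]_(t in `]0%R, 1%R]) (f t)%:E < +oo)%E ->
  (\int[mu]_(t in `[1%R, +oo[) (f t)%:E < +oo)%E ->
  mu.-integrable half_line (EFin \o f).
Proof.
move=> mf f0 fin0 finy.
have U : half_line = `]0%R, 1%R] `|` `]1%R, +oo[ :> set (measurableTypeR R).
  by rewrite /half_line (@itv_bndbnd_setU _ _ _ (BRight 1)) ?bnd_simp.
apply/integrableP; split; first exact/measurable_EFinP.
rewrite (_ : (\int[mu]_(t in half_line) _)%E =
             (\int[mu]_(t in half_line) (f t)%:E)%E); last first.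
  apply: eq_integral => t; rewrite inE => /half_lineP t0.
  by rewrite /= ger0_norm ?f0.
have mf1 : measurable_fun (`]1%R, +oo[ : set (measurableTypeR R)) f.
  by apply: measurable_funS mf => //; rewrite U; exact: subsetUr.
rewrite U ge0_integral_setU//=.
- rewrite lte_add_pinfty// integral_itv_obnd_cbnd//.
  exact/measurable_EFinP.
- by rewrite -U; exact/measurable_EFinP.
- by move=> t tU; rewrite lee_fin f0//; apply/half_lineP; rewrite U.
- apply/disj_setPS => t [/=]; rewrite !in_itv/= => /andP[_ t1].
  by rewrite andbT ltNge t1.
Qed.

(** The energy density of the estimate below. *)
Lemma square_over_primitive u g : primitive u g ->
  primitive (fun t => u t ^+ 2 / t)
            (fun t => 2 * (u t / t) * g t - (u t / t) ^+ 2).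
Proof.
move=> pu.
have pV : primitive (fun t : R => t^-1) (fun t => - t ^- 2).
  apply: derive_primitive => t t0.
    have := @is_deriveV _ id t 1 1 (lt0r_neq0 t0) _.
    by rewrite /GRing.scale/= mulr1; apply.
  apply: cvgN; apply: cvgV; first by rewrite expf_neq0// gt_eqF.
  exact: exprn_continuous.
apply: eq_primitive (primitiveM (primitiveM pu pu) pV) => t t0.
  by rewrite expr2.
by field; rewrite gt_eqF.
Qed.

(** A Hardy inequality by energy. If u' = - gam u/t + w and q = u/t, then
    (u^2/t)' = - (2 gam + 1) q^2 + 2 q w <= - 2 gam q^2 + w^2. Integration over
    [e, 1] bounds the integral of q^2 uniformly in e, because the boundary term
    u(e)^2/e is at most 1. Beyond 1, q is dominated by u. *)
Lemma hardy_sqint u w (gam c : R) : 0 < gam -> 0 < c ->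
  primitive u (fun t => - gam * (u t / t) + w t) ->
  sqint u -> sqint w ->
  (forall t, 0 < t < c -> u t ^+ 2 <= t) ->
  sqint (fun t => u t / t).
Proof.
move=> gam0 c0 pu su sw uc.
have cu t : 0 < t -> {for t, continuous u} by exact: primitive_continuous pu.
have cq t : 0 < t -> {for t, continuous (fun t => u t / t)}.
  move=> t0; apply: cvgM; first exact: cu.
  by apply: cvgV; [rewrite gt_eqF|exact: cvg_id].
have mq := continuous_measurable_half cq.
have mq2 : measurable_fun half_line (fun t => (u t / t) ^+ 2) by exact: measurable_funX.
split=> //.
have iw := sw.2.
pose W := \int[mu]_(t in half_line) (w t ^+ 2).
have iq : locint (fun t => (u t / t) ^+ 2).
  apply: continuous_locint => t t0.
  apply: (@continuous_comp _ _ _ (fun t => u t / t) (fun x => x ^+ 2)).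
    exact: cq.
  exact: exprn_continuous.
apply: integrable_half_split => // [t _||]; first by rewrite sqr_ge0.
- apply: le_lt_trans (ltry ((1 + W) / (2 * gam))).
  apply: (@integral_near0_le _ _ (Num.min c 1)) => //.
  + by move=> t _; rewrite sqr_ge0.
  + by rewrite lt_min c0/=.
  move=> e; rewrite lt_min => /and3P[e0 ec e1].
  have iqe := iq e 1 e0.
  rewrite -[X in (X <= _)%E]fineK; last exact: (integrable_fin_num (measurable_itvR _) iqe).
  rewrite lee_fin -[X in X <= _]/(\int[mu]_(t in `[e, 1]) ((u t / t) ^+ 2)).
  rewrite ler_pdivlMr ?mulr_gt0// mulrC.
  have [is_ ps] := square_over_primitive pu.
  have := ps e 1 e0 (ltW e1); rewrite divr1 => E1.
  have iwe := integrable_half_segment 1 e0 iw.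
  have le1 : \int[mu]_(t in `[e, 1])
       (2 * (u t / t) * (- gam * (u t / t) + w t) - (u t / t) ^+ 2) <=
     \int[mu]_(t in `[e, 1]) (w t ^+ 2 - 2 * gam * (u t / t) ^+ 2).
    apply: (le_Rintegral (measurable_itvR _) (is_ e 1 e0)).
      exact: (integrableB (measurable_itvR _) iwe
        (integrableZl (measurable_itvR _) (2 * gam) iqe)).
    move=> t _; have := sqr_ge0 (u t / t - w t).
    by move: (u t / t) (w t) => q v; nra.
  have iqe2 := integrableZl (measurable_itvR _) (2 * gam) iqe.
  move: le1; rewrite -E1 (RintegralB (measurable_itvR _) iwe iqe2).
  rewrite (RintegralZl _ (measurable_itvR _) iqe).
  have wW : \int[mu]_(t in `[e, 1]) (w t ^+ 2) <= W.
    rewrite -lee_fin /W /Rintegral !fineK.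
    - apply: ge0_subset_integral => //.
      + by case/integrableP : iw.
      + by move=> t _; rewrite lee_fin sqr_ge0.
      + by move=> t /= te; apply/half_lineP; exact: segment_pos te.
    - exact: (integrable_fin_num measurable_half_line iw).
    - exact: (integrable_fin_num (measurable_itvR _) iwe).
  have ue : u e ^+ 2 / e <= 1 by rewrite ler_pdivrMr// mul1r uc// e0 ec.
  by have := sqr_ge0 (u 1); lra.
- have iu := su.2.
  have : (\int[mu]_(t in half_line) (u t ^+ 2)%:E < +oo)%E.
    exact: (integrable_lty measurable_half_line iu).
  apply: le_lt_trans.
  apply: (@le_trans _ _ (\int[mu]_(t in `[1%R, +oo[) (u t ^+ 2)%:E)%E).
    have sub : `[1, +oo[%classic `<=` @half_line R.
      move=> t /=; rewrite in_itv/= andbT => t1; apply/half_lineP.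
      exact: lt_le_trans t1.
    apply: ge0_le_integral => //.
    + by move=> t _; rewrite lee_fin sqr_ge0.
    + apply/measurable_EFinP; exact: measurable_funS mq2.
    + apply/measurable_EFinP; apply: (measurable_funS measurable_half_line sub).
      by apply: measurable_funX; exact: su.1.
    + move=> t /=; rewrite in_itv/= andbT => t1; rewrite lee_fin.
      rewrite exprMn ler_piMr ?sqr_ge0// exprVn invf_le1 ?exprn_gt0//.
        exact: exprn_ege1.
      exact: lt_le_trans t1.
  apply: ge0_subset_integral => //.
  + by case/integrableP : iu.
  + by move=> t _; rewrite lee_fin sqr_ge0.
  + move=> t /=; rewrite in_itv/= andbT => t1; apply/half_lineP.
    exact: lt_le_trans t1.
Qed.

End Energy.

(** * Absolute continuity up to the origin *)

Section AbsoluteContinuity.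
Context {R : realType}.
Notation mu := (@lebesgue_measure R).
Implicit Types (f g u w : R -> R) (a b x y t e c C eta : R).

Let itv_half a b : 0 <= a -> `]a, b]%classic `<=` @half_line R.
Proof.
by move=> a0 t /=; rewrite in_itv/= => /andP[/(le_lt_trans a0) t0 _]; apply/half_lineP.
Qed.

Lemma integrable_half_itv f a b : 0 <= a ->
  mu.-integrable half_line (EFin \o f) -> mu.-integrable `]a, b] (EFin \o f).
Proof.
move=> a0; apply: integrableS; last exact: itv_half.
  exact: measurable_half_line.
exact: measurable_itvR.
Qed.

Lemma Rintegral_half_le f (A B : set (measurableTypeR R)) :
  measurable A -> measurable B -> A `<=` B -> B `<=` half_line ->
  mu.-integrable half_line (EFin \o f) -> (forall t, 0 <= f t) ->
  \int[mu]_(t in A) f t <= \int[mu]_(t in B) f t.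
Proof.
move=> mA mB AB BH iF f0.
have iB : mu.-integrable B (EFin \o f) by exact: integrableS iF.
have iA : mu.-integrable A (EFin \o f) by exact: integrableS iB.
rewrite -lee_fin /Rintegral !fineK.
- apply: ge0_subset_integral => //.
  + by case/integrableP : iB.
  + by move=> t _; rewrite lee_fin.
- exact: (integrable_fin_num mB iB).
- exact: (integrable_fin_num mA iA).
Qed.

Lemma sum_integral_disjoint f n (a b : 'I_n -> R) :
  mu.-integrable half_line (EFin \o f) -> (forall t, 0 <= f t) ->
  (forall i, 0 <= a i) -> (forall i j, i != j -> b i <= a j \/ b j <= a i) ->
  \sum_(i < n) \int[mu]_(t in `]a i, b i]) f t <= \int[mu]_(t in half_line) f t.
Proof.
move=> iF f0 a0 disj.
pose F (i : 'I_n) : set (measurableTypeR R) := `]a i, b i]%classic.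
have mF i : measurable (F i) by exact: measurable_itvR.
have tF : trivIset [set` index_enum 'I_n] F.
  apply/trivIsetP => i j _ _ /disj ij; apply/seteqP; split=> // t.
  rewrite /F /= !in_itv/= => -[/andP[ait tbi] /andP[ajt tbj]].
  case: ij => h.
    by have := le_lt_trans (le_trans tbi h) ajt; rewrite ltxx.
  by have := le_lt_trans (le_trans tbj h) ait; rewrite ltxx.
pose D := \big[setU/set0]_(i < n) F i.
have mD : measurable D by exact: bigsetU_measurable.
have DH : D `<=` half_line.
  by move=> t; rewrite /D -bigcup_seq => -[i _]; exact: itv_half.
have iD : mu.-integrable D (EFin \o f) by exact: integrableS iF.
apply: le_trans (Rintegral_half_le mD measurable_half_line DH _ iF f0); last by [].
rewrite -lee_fin -sumEFin.
rewrite (eq_bigr (fun i => (\int[mu]_(t in F i) (f t)%:E)%E)); last first.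
  move=> i _; rewrite /Rintegral fineK//.
  by apply: (integrable_fin_num (mF i)); exact: integrable_half_itv.
rewrite /Rintegral fineK; last exact: (integrable_fin_num mD iD).
rewrite -ge0_integral_bigsetU//=.
- exact: index_enum_uniq.
- by case/integrableP : iD.
- by move=> t _; rewrite lee_fin.
Qed.

(** The inequality |g| <= eta g^2 + 1/eta replaces Cauchy-Schwarz: unlike a
    square root, its right-hand side is additive over disjoint intervals. *)
Lemma primitive_increment_le u g eta a b : primitive u g -> sqint g ->
  0 < eta -> 0 < a -> a <= b ->
  `|u b - u a| <= eta * \int[mu]_(t in `]a, b]) (g t ^+ 2) + (b - a) / eta.
Proof.
move=> [ig ug] sg eta0 a0 ab; have ig2 := sqint_locint_sqr sg.
have ic : locint (fun=> eta^-1).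
  by apply: continuous_locint => t _; exact: cst_continuous.
have iS : locint (fun t => eta * g t ^+ 2 + eta^-1).
  by apply: locintD => //; exact: locintZ.
rewrite ug//; apply: le_trans (le_norm_locint ig iS a0 _) _.
  move=> t _; rewrite -(real_normK (num_real (g t))).
  set p := `|g t|; have p0 : 0 <= eta * p.
    by apply: mulr_ge0; [exact: ltW|exact: normr_ge0].
  rewrite -(ler_pM2l eta0) mulrDr mulfV ?gt_eqF//.
  by have := sqr_ge0 (eta * p - 1); nra.
rewrite (RintegralD (measurable_itvR _) (locintZ _ ig2 b a0) (ic a b a0)).
rewrite (RintegralZl _ (measurable_itvR _) (ig2 a b a0)) Rintegral_cst//=.
rewrite Rintegral_itv_obnd_cbnd; last first.
  by apply: integrable_half_itv sg.2; exact: ltW.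
rewrite lebesgue_measure_itv/= lte_fin [eta^-1 * _]mulrC.
by move: ab; rewrite le_eqVlt => /predU1P[->|->] //=; rewrite ltxx/= subrr.
Qed.

(** The value 0 at the origin is the limit of u when u^2 <= t near 0. *)
Definition extend0 u := fun t => if 0 < t then u t else 0.

(** For a = 0 the increment is the limit of the increments over ]t, b], as the
    hypothesis near 0 makes u t small. *)
Lemma extend0_increment_le u g eta c a b : primitive u g -> sqint g ->
  0 < c -> (forall t, 0 < t < c -> u t ^+ 2 <= t) ->
  0 < eta -> 0 <= a -> a < b ->
  `|extend0 u b - extend0 u a| <=
    eta * \int[mu]_(t in `]a, b]) (g t ^+ 2) + (b - a) / eta.
Proof.
move=> pu sg c0 uc eta0; rewrite le_eqVlt => /predU1P[<-|a0] ab; last first.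
  rewrite /extend0 a0 (lt_trans a0 ab).
  exact: (primitive_increment_le pu sg eta0 a0 (ltW ab)).
rewrite /extend0 ab ltxx !subr0; apply/ler_addgt0Pr => e e0.
pose t := Num.min (Num.min (c / 2) (e ^+ 2)) b.
have t0 : 0 < t by rewrite !lt_min divr_gt0// exprn_gt0.
have [tc te tb] : [/\ t < c, t <= e ^+ 2 & t <= b].
  have : t <= t by []; rewrite {2}/t !le_min => /andP[/andP[t2 te] tb]; split=> //.
  by apply: le_lt_trans t2 _; rewrite ltr_pdivrMr// ltr_pMr// ltr1n.
have ut : `|u t| <= e.
  rewrite -(@ler_pXn2r _ 2) ?nnegrE ?(ltW e0)// real_normK ?num_real//.
  by rewrite (le_trans (uc t _))// t0.
have := primitive_increment_le pu sg eta0 t0 tb.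
have J : \int[mu]_(s in `]t, b]) (g s ^+ 2) <= \int[mu]_(s in `]0, b]) (g s ^+ 2).
  apply: (@Rintegral_half_le (fun s => g s ^+ 2)).
  - exact: measurable_itvR.
  - exact: measurable_itvR.
  - by move=> s /=; rewrite !in_itv/= => /andP[/(lt_trans t0) -> ->].
  - exact: itv_half.
  - exact: sg.2.
  - by move=> s; exact: sqr_ge0.
have T : (b - t) / eta <= b / eta by rewrite ler_pM2r ?invr_gt0// lerBlDr lerDl ltW.
have := ler_normD (u b - u t) (u t); rewrite subrK => N1 N2.
apply: (le_trans N1); apply: lerD ut; apply: (le_trans N2).
by apply: lerD T; rewrite ler_pM2l.
Qed.

(** Summing the increment bounds gives eta G + (total length)/eta, where G is the
    full integral of g^2: first eta is chosen, then the length. *)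
Lemma extend0_abs_cont u g c : primitive u g -> sqint g ->
  0 < c -> (forall t, 0 < t < c -> u t ^+ 2 <= t) ->
  forall e, 0 < e -> exists2 d, 0 < d &
    forall n (a b : 'I_n -> R), (forall i, 0 <= a i /\ a i < b i) ->
      (forall i j, i != j -> b i <= a j \/ b j <= a i) ->
      \sum_(i < n) (b i - a i) < d ->
      \sum_(i < n) `|extend0 u (b i) - extend0 u (a i)| < e.
Proof.
move=> pu sg c0 uc e e0.
pose G := \int[mu]_(t in half_line) (g t ^+ 2).
have G0 : 0 <= G by apply: Rintegral_ge0 => t _; exact: sqr_ge0.
pose eta := e / (2 * (G + 1)).
have G1 : 0 < 2 * (G + 1) by rewrite mulr_gt0// ltr_wpDl.
have eta0 : 0 < eta by rewrite divr_gt0.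
exists (eta * (e / 2)) => [|n a b ab disj small]; first by rewrite mulr_gt0// divr_gt0.
apply: (@le_lt_trans _ _ (\sum_(i < n)
   (eta * \int[mu]_(t in `]a i, b i]) (g t ^+ 2) + (b i - a i) / eta))).
  apply: ler_sum => i _; have [a0 aib] := ab i.
  exact: extend0_increment_le pu sg c0 uc eta0 a0 aib.
rewrite big_split/= -mulr_sumr -mulr_suml.
rewrite [ltRHS]splitr; apply: ler_ltD; last first.
  by rewrite ltr_pdivrMr// mulrC.
have sG : \sum_(i < n) \int[mu]_(t in `]a i, b i]) (g t ^+ 2) <= G.
  apply: (@sum_integral_disjoint (fun t => g t ^+ 2)) => //; first exact: sg.2.
    by move=> t; exact: sqr_ge0.
  by move=> i; case: (ab i).
apply: (@le_trans _ _ (eta * (G + 1))).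
  by rewrite ler_pM2l// (le_trans sG)// lerDl.
rewrite /eta invfM mulrA mulfVK// gt_eqF//; lra.
Qed.

End AbsoluteContinuity.

(** * Real and imaginary parts *)

Section Complex.
Context {R : realType}.
Notation mu := (@lebesgue_measure R).
Implicit Types (f u : R -> R[i]) (c r t : R).

Lemma ReMr (c : R) (z : R[i]) : complex.Re (c%:C * z) = c * complex.Re z.
Proof. by case: z => a b /=; rewrite mul0r subr0. Qed.

Lemma ImMr (c : R) (z : R[i]) : complex.Im (c%:C * z) = c * complex.Im z.
Proof. by case: z => a b /=; rewrite mul0r addr0. Qed.

Lemma ReD (z w : R[i]) : complex.Re (z + w) = complex.Re z + complex.Re w.
Proof. by case: z; case: w. Qed.

Lemma ImD (z w : R[i]) : complex.Im (z + w) = complex.Im z + complex.Im w.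
Proof. by case: z; case: w. Qed.

Lemma ReMl (z : R[i]) (c : R) : complex.Re (z * c%:C) = complex.Re z * c.
Proof. by rewrite mulrC ReMr mulrC. Qed.

Lemma ImMl (z : R[i]) (c : R) : complex.Im (z * c%:C) = complex.Im z * c.
Proof. by rewrite mulrC ImMr mulrC. Qed.

Lemma reF_scale (c : R -> R) f :
  reF (fun r => (c r)%:C * f r) = fun r => c r * reF f r.
Proof. by apply/funext => r; rewrite /reF ReMr. Qed.

Lemma imF_scale (c : R -> R) f :
  imF (fun r => (c r)%:C * f r) = fun r => c r * imF f r.
Proof. by apply/funext => r; rewrite /imF ImMr. Qed.

Lemma normc_le_ReIm (z : R[i]) : normc z <= `|complex.Re z| + `|complex.Im z|.
Proof.
case: z => a b /=; rewrite -(@ler_pXn2r _ 2) ?nnegrE ?sqrtr_ge0 ?addr_ge0//.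
rewrite sqr_sqrtr ?addr_ge0 ?sqr_ge0// sqrrD !real_normK ?num_real//.
by rewrite addrAC lerDl mulrn_wge0// mulr_ge0.
Qed.

Lemma Re_le_normc (z : R[i]) : `|complex.Re z| <= normc z.
Proof.
case: z => a b /=; rewrite -sqrtr_sqr ler_wsqrtr// lerDl sqr_ge0//.
Qed.

Lemma Im_le_normc (z : R[i]) : `|complex.Im z| <= normc z.
Proof.
case: z => a b /=; rewrite -sqrtr_sqr ler_wsqrtr// lerDr sqr_ge0//.
Qed.

Lemma primitive_in_J u (gr gi : R -> R) (c : R) :
  primitive (reF u) gr -> primitive (imF u) gi -> sqint gr -> sqint gi ->
  sqint (fun r => reF u r / r) -> sqint (fun r => imF u r / r) ->
  0 < c -> (forall r, 0 < r < c -> reF u r ^+ 2 <= r) ->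
  (forall r, 0 < r < c -> imF u r ^+ 2 <= r) -> in_J u.
Proof.
move=> pr pi sr si qr qi c0 cr ci.
exists (fun r => if 0 < r then u r else 0), (fun r => gr r +i* gi r); split.
- by move=> r ->.
- move=> M M0 e e0.
  have e20 : 0 < e / 2 by rewrite divr_gt0.
  have [d d0 Hd] := extend0_abs_cont pr sr c0 cr e20.
  have [d' d'0 Hd'] := extend0_abs_cont pi si c0 ci e20.
  exists (Num.min d d') => [|n a b ab disj]; first by rewrite lt_min d0.
  rewrite lt_min => /andP[small small'].
  have ab' i : 0 <= a i /\ a i < b i by have [? []] := ab i.
  have := ltrD (Hd n a b ab' disj small) (Hd' n a b ab' disj small').
  rewrite -splitr; apply: le_lt_trans; rewrite -big_split/=.
  apply: ler_sum => i _; apply: le_trans (normc_le_ReIm _) _.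
  by rewrite /extend0 /reF /imF; case: ifP => _; case: ifP => _;
    rewrite ?raddfB/= ?subr0.
- apply/L2P; split.
    move: qr; congr sqint; apply/funext => r.
    by rewrite /reF -fmorphV ReMl.
  move: qi; congr sqint; apply/funext => r.
  by rewrite /imF -fmorphV ImMl.
- by apply/L2P; split.
- have := primitive_ae_derive pr; have := primitive_ae_derive pi.
  apply: filterS2; first exact: (ae_filter_ringOfSetsType mu).
  by move=> r di dr r0; split; [exact: dr|exact: di].
Qed.

Lemma regular_real_test f (phi : R -> R) :
  regular f (fun r => (phi r)%:C) =
  (\int[mu]_(r in `]0, +oo[) (reF f r * phi r)) +i*
  (\int[mu]_(r in `]0, +oo[) (imF f r * phi r)).
Proof.
rewrite /regular /cint; congr (_ +i* _); apply: eq_Rintegral => r _.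
  by rewrite {1}/reF ReMl.
by rewrite {1}/imF ImMl.
Qed.

Lemma regular_real_fun (p : R -> R) (phi : R -> R[i]) :
  regular (fun r => (p r)%:C) phi =
  (\int[mu]_(r in `]0, +oo[) (p r * reF phi r)) +i*
  (\int[mu]_(r in `]0, +oo[) (p r * imF phi r)).
Proof.
rewrite /regular /cint; congr (_ +i* _); apply: eq_Rintegral => r _.
  by rewrite {1}/reF ReMr.
by rewrite {1}/imF ImMr.
Qed.

Lemma cderive_real (phi : R -> R) :
  cderive (fun r => (phi r)%:C) = fun r => (derive1 phi r)%:C.
Proof.
by apply/funext => r; rewrite /cderive /reF /imF /= derive1_cst.
Qed.

Lemma real_test_fun (phi : R -> R) : real_test phi ->
  test_fun (fun r => (phi r)%:C).
Proof.
move=> [sphi [a [b [a0 phi0]]]]; split=> //.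
  rewrite (_ : imF _ = fun t => 0 * phi (1 * t + 0)); first exact: smooth_affine.
  by apply/funext => t; rewrite mul0r.
by exists a, b; split=> // r /phi0 ->.
Qed.

Lemma test_fun_re (phi : R -> R[i]) : test_fun phi -> real_test (reF phi).
Proof.
move=> [sr _ [a [b [a0 phi0]]]]; split; first exact: sr.
by exists a, b; split=> [|r /phi0 p0]; [exact: a0|rewrite /reF p0].
Qed.

Lemma test_fun_im (phi : R -> R[i]) : test_fun phi -> real_test (imF phi).
Proof.
move=> [_ si [a [b [a0 phi0]]]]; split; first exact: si.
by exists a, b; split=> [|r /phi0 p0]; [exact: a0|rewrite /imF p0].
Qed.

(** The common shape of both components of the weak Dirac equation, solved for the
    derivative; s is the sign that this requires. *)
Lemma test_integral_combination (A1 A2 A3 : R -> R) (s : R) (phi : R -> R) :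
  locint A1 -> locint A2 -> locint A3 -> real_test phi ->
  \int[mu]_(r in `]0, +oo[) ((s * (A1 r + A2 r - A3 r)) * phi r) =
  s * (\int[mu]_(r in `]0, +oo[) (A1 r * phi r) +
       \int[mu]_(r in `]0, +oo[) (A2 r * phi r) -
       \int[mu]_(r in `]0, +oo[) (A3 r * phi r)).
Proof.
move=> i1 i2 i3 [sphi [a [b [a0 phi0]]]].
have ip (A : R -> R) : locint A ->
    mu.-integrable half_line (EFin \o (fun r => A r * phi r)).
  move=> iA; apply: (@integrable_support _ _ a b) => //.
    apply: (@eq_locint _ (fun r => phi r * A r)); first by move=> t _; rewrite mulrC.
    by apply: locintM => // t _; exact: smooth_continuous.
  by move=> r /phi0 ->; rewrite mulr0.
have i12 := integrableD measurable_half_line (ip _ i1) (ip _ i2).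
have iall := integrableB measurable_half_line i12 (ip _ i3).
rewrite -(RintegralD measurable_half_line (ip _ i1) (ip _ i2)).
rewrite -(RintegralB measurable_half_line i12 (ip _ i3)).
rewrite -(RintegralZl s measurable_half_line iall).
by apply: eq_Rintegral => r _ /=; ring.
Qed.

End Complex.

(** * The maximal operator as an integral equation *)

Section MaximalOperator.
Context {R : realType}.
Variables (m nu mu lambda : R) (k : int).
Notation leb := (@lebesgue_measure R).
Let kap : R := k%:~R + lambda.

(** The equation h^* F = G in integral form. Its coefficients are real, so the
    real and the imaginary parts of F and G satisfy it separately. The signs 1
    and -1 are left unsimplified to fit test_integral_combination. *)
Definition dirac_system (p q g1 g2 : R -> R) :=
  primitive q (fun t => 1 * ((m + (nu + mu) / t) * p t + kap / t * q t - g1 t)) /\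
  primitive p (fun t =>
    -1 * (kap / t * p t + (- m + (nu - mu) / t) * q t - g2 t)).

Let coef_locint (a b : R) (f : R -> R) : locint f ->
  locint (fun t => (a + b / t) * f t).
Proof.
apply: locintM => t t0; apply: cvgD; first exact: cvg_cst.
by apply: cvgM; [exact: cvg_cst|apply: cvgV; [rewrite gt_eqF|exact: cvg_id]].
Qed.

Let coef0_locint (b : R) (f : R -> R) : locint f -> locint (fun t => b / t * f t).
Proof.
by move=> /(coef_locint 0 b); apply: eq_locint => t _; rewrite add0r.
Qed.

Lemma h_max_dirac_system (F G : spinor R) : h_max m nu mu lambda k F G ->
  dirac_system (reF F.1) (reF F.2) (reF G.1) (reF G.2) /\
  dirac_system (imF F.1) (imF F.2) (imF G.1) (imF G.2).
Proof.
move=> [[_ _] cF [/L2P[/sqint_locint ig1r /sqint_locint ig1i]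
                   /L2P[/sqint_locint ig2r /sqint_locint ig2i]] E1 E2].
have c1r t : 0 < t -> {for t, continuous (reF F.1)} by case/cF.
have c1i t : 0 < t -> {for t, continuous (imF F.1)} by case/cF.
have c2r t : 0 < t -> {for t, continuous (reF F.2)} by case/cF.
have c2i t : 0 < t -> {for t, continuous (imF F.2)} by case/cF.
have i1r := continuous_locint c1r; have i1i := continuous_locint c1i.
have i2r := continuous_locint c2r; have i2i := continuous_locint c2i.
have H1 phi (tphi : real_test phi) := E1 _ (real_test_fun tphi).
have H2 phi (tphi : real_test phi) := E2 _ (real_test_fun tphi).
have comb (s : R) (f g h : R -> R) : locint f -> locint g -> locint h ->
    locint (fun t => s * (f t + g t - h t)).
  move=> lf lg lh; apply: locintZ; apply: locintD; first exact: locintD.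
  by apply: (@eq_locint _ (fun t => -1 * h t));
    [move=> t _; rewrite mulN1r|exact: locintZ].
split; split; apply: weak_derivative_primitive => //.
- by apply: comb => //; [exact: coef_locint|exact: coef0_locint].
- move=> phi tphi; rewrite test_integral_combination//; last 2 first.
  + exact: coef_locint.
  + exact: coef0_locint.
  have := congr1 (@complex.Re R) (H1 phi tphi).
  rewrite /ddistr !regular_real_test cderive_real regular_real_test /=.
  by rewrite !reF_scale -/kap; lra.
- by apply: comb => //; [exact: coef0_locint|exact: coef_locint].
- move=> phi tphi; rewrite test_integral_combination//; last 2 first.
  + exact: coef0_locint.
  + exact: coef_locint.
  have := congr1 (@complex.Re R) (H2 phi tphi).
  rewrite /ddistr !regular_real_test cderive_real regular_real_test /=.
  by rewrite !reF_scale -/kap; lra.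
- by apply: comb => //; [exact: coef_locint|exact: coef0_locint].
- move=> phi tphi; rewrite test_integral_combination//; last 2 first.
  + exact: coef_locint.
  + exact: coef0_locint.
  have := congr1 (@complex.Im R) (H1 phi tphi).
  rewrite /ddistr !regular_real_test cderive_real regular_real_test /=.
  by rewrite !imF_scale -/kap; lra.
- by apply: comb => //; [exact: coef0_locint|exact: coef_locint].
- move=> phi tphi; rewrite test_integral_combination//; last 2 first.
  + exact: coef0_locint.
  + exact: coef_locint.
  have := congr1 (@complex.Im R) (H2 phi tphi).
  rewrite /ddistr !regular_real_test cderive_real regular_real_test /=.
  by rewrite !imF_scale -/kap; lra.
Qed.

Lemma dirac_system_h_max (p q g1 g2 : R -> R) :
  sqint p -> sqint q -> sqint g1 -> sqint g2 -> dirac_system p q g1 g2 ->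
  h_max m nu mu lambda k (fun r => (p r)%:C, fun r => (q r)%:C)
                         (fun r => (g1 r)%:C, fun r => (g2 r)%:C).
Proof.
move=> sp sq s1 s2 [pq pp].
have cp t : 0 < t -> {for t, continuous p} by exact: primitive_continuous pp.
have cq t : 0 < t -> {for t, continuous q} by exact: primitive_continuous pq.
have s0 : sqint (fun=> 0 : R).
  have := sqintZ 0 sp; congr sqint; apply/funext => r; exact: mul0r.
have L2r (f : R -> R) : sqint f -> L2 (fun r => (f r)%:C) by move=> sf; apply/L2P; split.
have ip := sqint_locint sp; have iq := sqint_locint sq.
have i1 := sqint_locint s1; have i2 := sqint_locint s2.
have EC (c f : R -> R) : (fun r => (c r)%:C * (f r)%:C) = fun r => (c r * f r)%:C.
  by apply/funext => r; rewrite rmorphM.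
split=> /=.
- by split; exact: L2r.
- move=> r r0; split; [exact: cp| |exact: cq|].
    by rewrite /imF /=; exact: cst_continuous.
  by rewrite /imF /=; exact: cst_continuous.
- by split; exact: L2r.
- move=> phi tphi; rewrite /ddistr !EC !regular_real_fun -/kap.
  have -> : reF (cderive phi) = derive1 (reF phi) by [].
  have -> : imF (cderive phi) = derive1 (imF phi) by [].
  have tr := test_fun_re tphi; have ti := test_fun_im tphi.
  have la := coef_locint m (nu + mu) ip; have lb := coef0_locint kap iq.
  rewrite (primitive_weak_derivative pq tr) (primitive_weak_derivative pq ti).
  rewrite (test_integral_combination _ la lb i1 tr).
  rewrite (test_integral_combination _ la lb i1 ti).
  apply/eqP; rewrite eq_complex /=; apply/andP; split; apply/eqP.
    move: (\int[_]_(_ in _) _) (\int[_]_(_ in _) _) (\int[_]_(_ in _) _).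
    by clear=> *; ring.
  move: (\int[_]_(_ in _) _) (\int[_]_(_ in _) _) (\int[_]_(_ in _) _).
  by clear=> *; ring.
- move=> phi tphi; rewrite /ddistr !EC !regular_real_fun -/kap.
  have -> : reF (cderive phi) = derive1 (reF phi) by [].
  have -> : imF (cderive phi) = derive1 (imF phi) by [].
  have tr := test_fun_re tphi; have ti := test_fun_im tphi.
  have la := coef0_locint kap ip; have lb := coef_locint (- m) (nu - mu) iq.
  rewrite (primitive_weak_derivative pp tr) (primitive_weak_derivative pp ti).
  rewrite (test_integral_combination _ la lb i2 tr).
  rewrite (test_integral_combination _ la lb i2 ti).
  apply/eqP; rewrite eq_complex /=; apply/andP; split; apply/eqP.
    move: (\int[_]_(_ in _) _) (\int[_]_(_ in _) _) (\int[_]_(_ in _) _).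
    by clear=> *; ring.
  move: (\int[_]_(_ in _) _) (\int[_]_(_ in _) _) (\int[_]_(_ in _) _).
  by clear=> *; ring.
Qed.

End MaximalOperator.

(** * Integrability of powers *)

Section Powers.
Context {R : realType}.
Notation mu := (@lebesgue_measure R).
Implicit Types (f g q : R -> R) (a p r t e c C : R).

Lemma powR_continuous_pos p t : 0 < t -> {for t, continuous (fun r : R => r `^ p)}.
Proof. by move=> t0; apply: is_derive_continuous; exact: is_derive1_powR. Qed.

Lemma powR_primitive p : p != -1 ->
  primitive (fun r : R => r `^ (p + 1) / (p + 1)) (fun r => r `^ p).
Proof.
move=> p1; have p10 : p + 1 != 0 by rewrite addr_eq0.
apply: derive_primitive => t t0; last exact: powR_continuous_pos.
rewrite (_ : (fun r => _) = fun r => (p + 1)^-1 * r `^ (p + 1)); last first.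
  by apply/funext => r; rewrite mulrC.
rewrite (_ : t `^ p = (p + 1)^-1 * ((p + 1) * t `^ (p + 1 - 1))).
  by apply: derive_scale; exact: is_derive1_powR.
by rewrite mulKf// addrK.
Qed.

Lemma opp_inv_derive t : 0 < t -> is_derive t 1 (fun r : R => - r^-1) (t `^ (- 2)).
Proof.
move=> t0; rewrite powR_invn ?ltW// -[X in is_derive _ _ _ X]opprK.
apply: is_deriveN; have := @is_deriveV _ id t 1 1 (lt0r_neq0 t0) _.
by rewrite /GRing.scale/= mulr1; apply.
Qed.

(** For p >= -2 this is r^p up to 1 and r^(-2) beyond; as a minimum of
    continuous functions it is measurable without case distinction. *)
Definition power_envelope p r := Num.min (r `^ p) (r `^ (- 2)).

Lemma power_envelope_integrable p : - 1 < p ->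
  mu.-integrable half_line (EFin \o power_envelope p).
Proof.
move=> p1; have p10 : 0 < p + 1 by lra.
have mpow (s : R) : measurable_fun half_line (fun r : R => r `^ s).
  by apply: continuous_measurable_half => t; exact: powR_continuous_pos.
have mE : measurable_fun half_line (power_envelope p).
  exact: measurable_minr.
have E0 t : 0 <= power_envelope p t by rewrite le_min !powR_ge0.
have ipow (s : R) : locint (fun r : R => r `^ s).
  by apply: continuous_locint => t; exact: powR_continuous_pos.
apply: integrable_half_split => //.
- apply: le_lt_trans (ltry (p + 1)^-1).
  apply: (@integral_near0_le _ _ _ 1) => // e /andP[e0 e1].
  have iE : mu.-integrable `[e, 1] (EFin \o (fun r : R => r `^ p)) by exact: ipow.
  apply: (@le_trans _ _ (\int[mu]_(t in `[e, 1%R]) (t `^ p)%:E)%E).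
    apply: ge0_le_integral => //.
    + by move=> t _; rewrite lee_fin.
    + apply/measurable_EFinP; apply: measurable_funS mE => //.
      by move=> t /= te; apply/half_lineP; exact: segment_pos te.
    + by case/integrableP : iE.
    + by move=> t _; rewrite lee_fin ge_min lexx.
  rewrite -[leLHS]fineK; last exact: (integrable_fin_num (measurable_itvR _) iE).
  rewrite lee_fin.
  have [_ pE] : primitive (fun r : R => r `^ (p + 1) / (p + 1)) (fun r => r `^ p).
    by apply: powR_primitive; rewrite gt_eqF.
  rewrite -[leLHS]/(\int[mu]_(t in `[e, 1]) (t `^ p)) -pE ?(ltW e1)//.
  by rewrite powR1 mul1r lerBlDr lerDl divr_ge0 ?powR_ge0// ltW.
- apply: (@le_lt_trans _ _ (\int[mu]_(t in `[1%R, +oo[) (t `^ (- 2))%:E)%E).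
    have sub : `[1, +oo[%classic `<=` @half_line R.
      move=> t /=; rewrite in_itv/= andbT => t1; apply/half_lineP.
      exact: lt_le_trans t1.
    apply: ge0_le_integral => //.
    + by move=> t _; rewrite lee_fin.
    + apply/measurable_EFinP; exact: measurable_funS mE.
    + apply/measurable_EFinP; exact: (measurable_funS measurable_half_line sub (mpow _)).
    + by move=> t _; rewrite lee_fin ge_min lexx orbT.
  rewrite (@ge0_continuous_FTC2y _ _ (fun r => - r^-1) 1 0)//.
  + by rewrite -EFinB ltry.
  + by move=> t _; exact: powR_ge0.
  + apply: continuous_in_subspaceT => t; rewrite inE/= in_itv/= andbT => t1.
    by apply: powR_continuous_pos; exact: lt_le_trans t1.
  + rewrite -[X in _ --> X]oppr0; apply: cvgN.
    apply: (iffRL (gtr0_cvgV0 _)); last exact: cvg_id.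
    exact: nbhs_pinfty_gt.
  + by move=> t t1; case: (opp_inv_derive (lt_trans ltr01 t1)).
  + apply: cvg_at_right_filter.
    exact: (is_derive_continuous (opp_inv_derive ltr01)).
  + move=> t; rewrite in_itv/= andbT => t1.
    by apply: is_derive1E; exact: opp_inv_derive (lt_trans ltr01 t1).
Qed.

End Powers.

Section PowerWeights.
Context {R : realType}.
Notation mu := (@lebesgue_measure R).
Implicit Types (f g q : R -> R) (a p r t e c C gam : R).

(** The integral of c/t over [e, 1] is - c ln e; the point e is chosen so that it
    exceeds the integral of q^2 by 1. *)
Lemma inv_not_sqint q c : 0 < c -> (forall t, 0 < t <= 1 -> c / t <= q t ^+ 2) ->
  ~ sqint q.
Proof.
move=> c0 qc [_ iq].
pose Q := \int[mu]_(t in half_line) (q t ^+ 2).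
have Q0 : 0 <= Q by apply: Rintegral_ge0 => t _; exact: sqr_ge0.
pose e := expR (- ((Q + 1) / c)); have e0 : 0 < e by exact: expR_gt0.
have e1 : e <= 1 by rewrite expR_le1 oppr_le0 divr_ge0 ?addr_ge0// ltW.
have [iV pV] : primitive (fun t : R => c * ln t) (fun t => c / t).
  apply: derive_primitive => t t0.
    by apply: derive_scale; exact: is_derive1_ln.
  by apply: cvgM; [exact: cvg_cst|apply: cvgV; [rewrite gt_eqF|exact: cvg_id]].
have sub : `[e, 1]%classic `<=` @half_line R.
  by move=> t /= te; apply/half_lineP; exact: segment_pos te.
have iqe := integrable_half_segment 1 e0 iq.
have le1 : \int[mu]_(t in `[e, 1]) (c / t) <= \int[mu]_(t in `[e, 1]) (q t ^+ 2).
  apply: (le_Rintegral (measurable_itvR _) (iV e 1 e0) iqe) => t /=.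
  rewrite in_itv/= => /andP[et t1].
  by apply: qc; rewrite t1 (lt_le_trans e0).
have := @Rintegral_half_le _ (fun t => q t ^+ 2) _ _
  (measurable_itvR `[e, 1]) measurable_half_line sub
  (fun _ h => h) iq (fun t => sqr_ge0 _).
move/(le_trans le1); rewrite -pV// ln1 mulr0 sub0r /e expRK mulrN opprK mulrC.
rewrite divfK ?gt_eqF// -/Q; lra.
Qed.

(** Below c the square is at most a multiple of r^(2 (gam - a)), whose exponent
    exceeds -1; beyond c the weight is bounded. *)
Lemma sqint_powR f gam a C c : sqint f -> 0 < c <= 1 -> 0 <= a -> a < 2^-1 + gam ->
  (forall r, 0 < r < c -> `|f r| <= C * r `^ gam) ->
  sqint (fun r => r `^ (- a) * f r).
Proof.
move=> [mf sf] /andP[c0 c1] a0 agam fC.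
pose p := 2 * (gam - a); have p1 : - 1 < p by rewrite /p; lra.
apply: (@sqint_dominated _ _
    (fun r => C ^+ 2 * power_envelope p r + (c `^ (- a)) ^+ 2 * f r ^+ 2)).
- apply: measurable_funM => //; apply: continuous_measurable_half => t.
  exact: powR_continuous_pos.
- exact: (integrableD measurable_half_line
    (integrableZl measurable_half_line _ (power_envelope_integrable p1))
    (integrableZl measurable_half_line _ sf)).
- move=> r r0; have E0 : 0 <= power_envelope p r by rewrite le_min !powR_ge0.
  rewrite exprMn; have [rc|cr] := ltP r c.
    have -> : power_envelope p r = r `^ p.
      apply/min_idPl; apply: ger_powR; last lra.
      by rewrite r0 (le_trans (ltW rc)).
    apply: (@le_trans _ _ (C ^+ 2 * r `^ p)); last by rewrite lerDl mulr_ge0 ?sqr_ge0.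
    have -> : r `^ p = (r `^ (- a)) ^+ 2 * (r `^ gam) ^+ 2.
      rewrite -!powR_mulrn ?powR_ge0// -!powRrM -powRD; last first.
        by apply/implyP => _; rewrite gt_eqF.
      by congr (_ `^ _); rewrite /p; ring.
    rewrite [leRHS]mulrCA ler_wpM2l ?sqr_ge0// -exprMn -real_normK ?num_real//.
    have := fC r; rewrite r0 rc => /(_ isT) h.
    by rewrite lerXn2r ?nnegrE// (le_trans _ h).
  apply: (@le_trans _ _ ((c `^ (- a)) ^+ 2 * f r ^+ 2)); last first.
    by rewrite lerDr mulr_ge0 ?sqr_ge0.
  rewrite ler_wpM2r ?sqr_ge0// lerXn2r ?nnegrE ?powR_ge0//.
  rewrite !powRN lef_pV2 ?posrE ?powR_gt0//.
  by apply: ge0_ler_powR => //; rewrite nnegrE ltW.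
Qed.

End PowerWeights.

(** * Spectral algebra of the boundary matrix *)

Section BoundaryMatrix.
Context {R : realType}.
Variables (nu mu lambda : R) (k : int).
Hypothesis delta_gt0 : 0 < delta nu mu lambda k.
Let kap : R := k%:~R + lambda.
Let g : R := gamma nu mu lambda k.
Let D : 'M[R]_2 := Dmx nu mu lambda k.

Lemma gamma_gt0 : 0 < g. Proof. by rewrite sqrtr_gt0. Qed.

Lemma gamma_sqr : g ^+ 2 = kap ^+ 2 + mu ^+ 2 - nu ^+ 2.
Proof. by rewrite sqr_sqrtr// ltW. Qed.

(** The homogeneous system is r F' = M F, where M has the rows
    (- kap, - (nu - mu)) and (nu + mu, kap). The coefficients of phi^- form a
    left eigenvector of M for - g; the columns of D are right eigenvectors for
    g and - g, the first of which is annihilated by phi^-. *)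
Definition phi_coef1 : R := if kap - g != 0 then nu + mu else - 2 * g.
Definition phi_coef2 : R := if kap - g != 0 then kap - g else - nu + mu.

Lemma phi_minusE (F : spinor R) r :
  phi_minus nu mu lambda k F r = phi_coef1%:C * F.1 r + phi_coef2%:C * F.2 r.
Proof. by rewrite /phi_minus /phi_coef1 /phi_coef2 -/kap -/g; case: ifP. Qed.

Lemma phi_coef_eigen1 : - (phi_coef1 * kap) + phi_coef2 * (nu + mu) = - g * phi_coef1.
Proof.
rewrite /phi_coef1 /phi_coef2; have := gamma_sqr.
case: eqVneq => [/eqP|_ _] /=; last by ring.
rewrite subr_eq0 => /eqP -> h.
have -> : (- nu + mu) * (nu + mu) = 0 by rewrite mulrDl; lra.
by ring.
Qed.

Lemma phi_coef_eigen2 : - (phi_coef1 * (nu - mu)) + phi_coef2 * kap = - g * phi_coef2.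
Proof.
rewrite /phi_coef1 /phi_coef2; have := gamma_sqr.
case: eqVneq => [/eqP|_ h] /=; first by rewrite subr_eq0 => /eqP -> h; ring.
have -> : - ((nu + mu) * (nu - mu)) = g ^+ 2 - kap ^+ 2 by rewrite h; ring.
by ring.
Qed.

Let DE : D = if kap - g != 0 then
    (2 * g * (kap - g))^-1 *: mx2 (kap - g) (nu - mu) (- (nu + mu)) (- (kap - g))
  else (- 4 * g ^+ 2)^-1 *: mx2 (mu - nu) (2 * g) (2 * g) (- (nu + mu)).
Proof. by rewrite /D /Dmx -/g [lambda + _]addrC. Qed.

Lemma Dmx_col0_eigen1 : - kap * D 0 0 - (nu - mu) * D 1 0 = g * D 0 0.
Proof.
rewrite DE; have := gamma_sqr; have g0 := gamma_gt0.
case: eqVneq => [/eqP|ne h] /=; rewrite !mxE /=.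
  by rewrite subr_eq0 => /eqP -> h; ring.
by set c := _^-1; transitivity (c * (kap * g - g ^+ 2)); [rewrite h|]; ring.
Qed.

Lemma Dmx_col0_eigen2 : (nu + mu) * D 0 0 + kap * D 1 0 = g * D 1 0.
Proof.
rewrite DE; have := gamma_sqr; have g0 := gamma_gt0.
case: eqVneq => [/eqP|ne h] /=; rewrite !mxE /=; last by ring.
rewrite subr_eq0 => /eqP -> h; set c := _^-1.
have -> : (nu + mu) * (c * (mu - nu)) = c * (mu ^+ 2 - nu ^+ 2) by ring.
have -> : mu ^+ 2 - nu ^+ 2 = 0 by lra.
ring.
Qed.

Lemma Dmx_col1_eigen1 : - kap * D 0 1 - (nu - mu) * D 1 1 = - g * D 0 1.
Proof.
rewrite DE; have := gamma_sqr; have g0 := gamma_gt0.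
case: eqVneq => [/eqP|ne h] /=; rewrite !mxE /=; last by ring.
rewrite subr_eq0 => /eqP -> h; set c := _^-1.
have -> : (nu - mu) * (c * - (nu + mu)) = c * (mu ^+ 2 - nu ^+ 2) by ring.
have -> : mu ^+ 2 - nu ^+ 2 = 0 by lra.
ring.
Qed.

Lemma Dmx_col1_eigen2 : (nu + mu) * D 0 1 + kap * D 1 1 = - g * D 1 1.
Proof.
rewrite DE; have := gamma_sqr; have g0 := gamma_gt0.
case: eqVneq => [/eqP|ne h] /=; rewrite !mxE /=.
  by rewrite subr_eq0 => /eqP -> h; ring.
by set c := _^-1; transitivity (c * (g * kap - g ^+ 2)); [rewrite h|]; ring.
Qed.

Lemma phi_coef_Dmx_col0 : phi_coef1 * D 0 0 + phi_coef2 * D 1 0 = 0.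
Proof.
rewrite DE /phi_coef1 /phi_coef2; case: ifP => _; rewrite !mxE /=; ring.
Qed.

Lemma phi_coef_Dmx_col1 : phi_coef1 * D 0 1 + phi_coef2 * D 1 1 = 1.
Proof.
rewrite DE /phi_coef1 /phi_coef2; have h := gamma_sqr; have g0 := gamma_gt0.
case: eqVneq => [/eqP|ne] /=; rewrite !mxE /=.
  rewrite subr_eq0 => /eqP kg; rewrite kg in h.
  have -> : - 2 * g * ((- 4 * g ^+ 2)^-1 * (2 * g)) +
     (- nu + mu) * ((- 4 * g ^+ 2)^-1 * - (nu + mu)) =
     (- 4 * g ^+ 2)^-1 * (- 4 * g ^+ 2 - (mu ^+ 2 - nu ^+ 2)) by ring.
  have -> : mu ^+ 2 - nu ^+ 2 = 0 by lra.
  rewrite subr0 mulVf// mulf_neq0 ?oppr_eq0 ?pnatr_eq0//.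
  by rewrite expf_neq0// gt_eqF.
set c := 2 * g * (kap - g).
have -> : (nu + mu) * (c^-1 * (nu - mu)) + (kap - g) * (c^-1 * - (kap - g)) =
  c^-1 * ((nu ^+ 2 - mu ^+ 2) - (kap - g) ^+ 2) by ring.
have -> : nu ^+ 2 - mu ^+ 2 = kap ^+ 2 - g ^+ 2 by lra.
have -> : kap ^+ 2 - g ^+ 2 - (kap - g) ^+ 2 = c by rewrite /c; ring.
by rewrite mulVf// !mulf_neq0// ?gt_eqF//.
Qed.

End BoundaryMatrix.

Section NormC2.
Context {R : realType}.

Lemma normc_nonneg (z : R[i]) : 0 <= normc z.
Proof. by case: z => a b /=; exact: sqrtr_ge0. Qed.

Lemma boundary_entry (D : 'M[R]_2) (f1 f2 a b : R[i]) (i : 'I_2) :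
  (col2 f1 f2 - map_mx (real_complex R) D *m col2 a b) i 0 =
  (if i == 0 then f1 else f2) - ((D i 0)%:C * a + (D i 1)%:C * b).
Proof.
rewrite !mxE !big_ord_recl big_ord0 addr0 !mxE /=; congr (_ - (_ + _%:C * _)).
  by case: i => -[|[|]].
by congr (D _ _); apply/val_inj.
Qed.

Lemma normc_le_norm_C2 (v : 'cV[R[i]]_2) i : normc (v i 0) <= norm_C2 v.
Proof.
have s0 (P : pred 'I_2) : 0 <= \sum_(j | P j) normc (v j 0) ^+ 2.
  by rewrite sumr_ge0// => j _; exact: sqr_ge0.
rewrite -(@ler_pXn2r _ 2) ?nnegrE ?sqrtr_ge0 ?normc_nonneg// /norm_C2 sqr_sqrtr//.
by rewrite (bigD1 i)//= lerDl.
Qed.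

Lemma norm_C2_le (v : 'cV[R[i]]_2) : norm_C2 v <= normc (v 0 0) + normc (v 1 0).
Proof.
rewrite -(@ler_pXn2r _ 2) ?nnegrE ?sqrtr_ge0 ?addr_ge0 ?normc_nonneg//.
rewrite /norm_C2 sqr_sqrtr; last by rewrite sumr_ge0// => j _; exact: sqr_ge0.
rewrite !big_ord_recl big_ord0 addr0 sqrrD.
rewrite (_ : lift ord0 ord0 = 1); last by apply/val_inj.
by rewrite addrAC lerDl mulrn_wge0// mulr_ge0 ?normc_nonneg.
Qed.

End NormC2.

(** * The distinguished boundary condition *)

Section RegularSolution.
Context {R : realType}.
Variables (m nu mu lambda : R) (k : int).
Hypothesis delta_gt0 : 0 < delta nu mu lambda k.
Let kap : R := k%:~R + lambda.
Let g : R := gamma nu mu lambda k.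
Let D : 'M[R]_2 := Dmx nu mu lambda k.
Let al : R := phi_coef1 nu mu lambda k.
Let be : R := phi_coef2 nu mu lambda k.

(** The left eigenvector decouples the singular part of the system. *)
Lemma phi_minus_primitive (p q g1 g2 : R -> R) :
  dirac_system m nu mu lambda k p q g1 g2 ->
  primitive (fun t => al * p t + be * q t)
    (fun t => - g * ((al * p t + be * q t) / t) +
              (be * (m * p t + (-1) * g1 t) + al * (m * q t + g2 t))).
Proof.
move=> [pq pp]; apply: eq_primitive (primitiveD (primitiveZ al pp) (primitiveZ be pq)).
  by [].
move=> t t0; have e1 := phi_coef_eigen1 delta_gt0; have e2 := phi_coef_eigen2 delta_gt0.
rewrite -/kap -/al -/be -/g in e1 e2 *.
transitivity (((- (al * kap) + be * (nu + mu)) * p t +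
               (- (al * (nu - mu)) + be * kap) * q t) / t +
              (be * (m * p t + (-1) * g1 t) + al * (m * q t + g2 t))); first by ring.
by rewrite e1 e2; ring.
Qed.

Lemma phi_minus_regular (p q g1 g2 : R -> R) (c : R) :
  dirac_system m nu mu lambda k p q g1 g2 ->
  sqint p -> sqint q -> sqint g1 -> sqint g2 -> 0 < c ->
  (forall t, 0 < t < c -> (al * p t + be * q t) ^+ 2 <= t) ->
  let u t := al * p t + be * q t in
  sqint (fun t => u t / t) /\ exists2 w, sqint w & primitive u w.
Proof.
move=> sys sp sq s1 s2 c0 uc u.
have pu := phi_minus_primitive sys.
have su : sqint u by apply: sqintD; exact: sqintZ.
have sw : sqint (fun t => be * (m * p t + (-1) * g1 t) + al * (m * q t + g2 t)).
  apply: sqintD; apply: sqintZ; apply: sqintD; try exact: sqintZ.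
  exact: s2.
have sV := hardy_sqint (gamma_gt0 delta_gt0) c0 pu su sw uc.
split=> //; exists (fun t => - g * (u t / t) +
  (be * (m * p t + (-1) * g1 t) + al * (m * q t + g2 t))) => //.
by apply: sqintD => //; exact: sqintZ.
Qed.

Lemma normc_real (x : R) : normc x%:C = `|x|.
Proof. by rewrite /= expr0n/= addr0 sqrtr_sqr. Qed.

Lemma at_right0_near (P : R -> Prop) : (\forall r \near (0 : R)^'+, P r) ->
  exists2 c, 0 < c & forall r, 0 < r < c -> P r.
Proof.
move=> [c /= c0 H]; exists c => // r /andP[r0 rc]; apply: H => //=.
by rewrite sub0r normrN gtr0_norm.
Qed.

Definition regular_residual (F : spinor R) (A : R[i]) (i : 'I_2) r : R[i] :=
  (if i == 0 then F.1 r else F.2 r) - (D i 0)%:C * (A * (r `^ g)%:C).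

(** At theta = 0 the condition reads A^- = 0, which leaves the r^g branch. *)
Lemma boundary_cond0 (F : spinor R) : boundary_cond nu mu lambda k 0 F ->
  exists A : R[i], forall e, 0 < e -> exists2 c, 0 < c &
    forall r, 0 < r < c -> forall i, normc (regular_residual F A i r) <= e * r `^ 2^-1.
Proof.
move=> [A [A' [+ lim]]]; rewrite sin0 cos0 mulr0 add0r mulr1 => A'0.
exists A => e e0; have /cvgrPdist_le/(_ e e0) := lim.
move=> /at_right0_near[c c0 H]; exists c => // r rc i.
have {H} := H r rc; have /andP[r0 _] := rc.
rewrite sub0r normrN (powRN r 2^-1) ger0_norm; last first.
  by rewrite mulr_ge0 ?sqrtr_ge0 ?invr_ge0 ?powR_ge0.
rewrite ler_pdivrMr ?powR_gt0//; apply: le_trans.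
apply: le_trans (normc_le_norm_C2 _ i).
by rewrite boundary_entry A'0 mul0r mulr0 addr0.
Qed.

(** The error o(r^(1/2)) is absorbed by r^g because g < 1/2. *)
Lemma boundary0_growth (F : spinor R) : g < 2^-1 ->
  boundary_cond nu mu lambda k 0 F ->
  exists C c, 0 < c <= 1 /\ forall r, 0 < r < c ->
    normc (F.1 r) <= C * r `^ g /\ normc (F.2 r) <= C * r `^ g.
Proof.
move=> g2 /boundary_cond0[A /(_ 1 ltr01)[c c0 H]].
pose C := 1 + (`|D 0 0| + `|D 1 0|) * normc A.
exists C, (Num.min c 1); split; first by rewrite lt_min c0 ltr01 ge_min lexx orbT.
move=> r; rewrite lt_min => /and3P[r0 rc r1].
have bound i : `|D i 0| <= `|D 0 0| + `|D 1 0| ->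
    normc (if i == 0 then F.1 r else F.2 r) <= C * r `^ g.
  move=> Di; have := H r _ i; rewrite r0 rc => /(_ isT); rewrite mul1r => res.
  have -> : (if i == 0 then F.1 r else F.2 r) =
      regular_residual F A i r + (D i 0)%:C * (A * (r `^ g)%:C).
    by rewrite /regular_residual subrK.
  apply: le_trans (le_normcD _ _) _; rewrite !normcM !normc_real.
  rewrite [X in _ * (_ * X)]ger0_norm ?powR_ge0// /C mulrDl mul1r.
  apply: lerD.
    apply: (le_trans res); apply: ger_powR; last exact: ltW.
    by rewrite r0 ltW.
  by rewrite mulrA ler_wpM2r ?powR_ge0// ler_wpM2r// normc_nonneg.
by split; [apply: (bound 0)|apply: (bound 1)]; rewrite ?lerDl ?lerDr.
Qed.

(** The r^g branch is annihilated by phi^-, so only the error is left; it is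
    measured with a constant small enough to absorb the coefficients. *)
Lemma boundary0_phi_minus (F : spinor R) : boundary_cond nu mu lambda k 0 F ->
  exists2 c, 0 < c & forall r, 0 < r < c ->
    normc (phi_minus nu mu lambda k F r) ^+ 2 <= r.
Proof.
move=> /boundary_cond0[A H].
pose S := `|al| + `|be| + 1; have S0 : 0 < S by rewrite ltr_wpDl// addr_ge0.
have SV0 : 0 < S^-1 by rewrite invr_gt0.
have [c c0 Hc] := H _ SV0.
exists c => // r rc; have /andP[r0 _] := rc.
have r20 : 0 <= r `^ 2^-1 by exact: powR_ge0.
have -> : phi_minus nu mu lambda k F r =
    al%:C * regular_residual F A 0 r + be%:C * regular_residual F A 1 r.
  rewrite phi_minusE -/al -/be /regular_residual /=.
  have := phi_coef_Dmx_col0 nu mu lambda k; rewrite -/al -/be -/D => E.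
  transitivity (al%:C * F.1 r + be%:C * F.2 r -
     (al * D 0 0 + be * D 1 0)%:C * (A * (r `^ g)%:C)).
    by rewrite E mul0r subr0.
  by rewrite rmorphD !rmorphM /=; ring.
have small : normc (al%:C * regular_residual F A 0 r + be%:C * regular_residual F A 1 r)
    <= r `^ 2^-1.
  apply: le_trans (le_normcD _ _) _; rewrite !normcM !normc_real.
  apply: (@le_trans _ _ ((`|al| + `|be|) * (S^-1 * r `^ 2^-1))).
    by rewrite mulrDl; apply: lerD; apply: ler_wpM2l => //; exact: Hc.
  rewrite mulrA ler_piMl// ler_pdivrMr// mul1r /S lerDl//.
rewrite [leRHS](_ : r = (r `^ 2^-1) ^+ 2); last first.
  by rewrite powR12_sqrt ?ltW// sqr_sqrtr// ltW.
by rewrite lerXn2r ?nnegrE ?normc_nonneg.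
Qed.

End RegularSolution.

(** * A singular element of the domain *)

Section SingularSolution.
Context {R : realType}.
Variables (m nu mu lambda : R) (k : int).
Hypothesis delta_gt0 : 0 < delta nu mu lambda k.
Hypothesis gamma_lt : gamma nu mu lambda k < 2^-1.
Variables (ap am : R).
Let kap : R := k%:~R + lambda.
Let g : R := gamma nu mu lambda k.
Let D : 'M[R]_2 := Dmx nu mu lambda k.
Let al : R := phi_coef1 nu mu lambda k.
Let be : R := phi_coef2 nu mu lambda k.
Implicit Types (i : 'I_2) (r t : R).

(** The general solution of the homogeneous system, by its components. *)
Definition power_solution (i : 'I_2) r : R :=
  D i 0 * (ap * r `^ g) + D i 1 * (am * r `^ (- g)).

(** Smooth on the half-line and 1 + O(r) at 0; the decay r^(-2) is what makes the
    cut solution square integrable at infinity. *)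
Definition cutoff r : R := ((1 + r) ^+ 2)^-1.

Definition cut_solution i r := cutoff r * power_solution i r.

(** Minus the logarithmic derivative of the cut-off. *)
Definition damping r : R := 2 / (1 + r).

Let g0 : 0 < g. Proof. exact: gamma_gt0. Qed.

Let power_solution_derive i t : 0 < t -> is_derive t 1 (power_solution i)
  ((g * (D i 0 * (ap * t `^ g)) - g * (D i 1 * (am * t `^ (- g)))) / t).
Proof.
move=> t0.
have dp (c d s : R) : is_derive t 1 (fun r => c * (d * r `^ s))
    (s * (c * (d * t `^ s)) / t).
  have -> : s * (c * (d * t `^ s)) / t = c * (d * (s * t `^ (s - 1))).
    rewrite powRB ?powRr1 ?ltW//; first by ring.
    by apply/implyP => _; rewrite gt_eqF.
  by do 2 apply: derive_scale; exact: is_derive1_powR.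
have -> : (g * (D i 0 * (ap * t `^ g)) - g * (D i 1 * (am * t `^ (- g)))) / t =
    g * (D i 0 * (ap * t `^ g)) / t + - g * (D i 1 * (am * t `^ (- g))) / t.
  by ring.
exact: derive_add (dp _ _ _) (dp _ _ _).
Qed.

Let cutoff_derive t : 0 < t -> is_derive t 1 cutoff (- damping t * cutoff t).
Proof.
move=> t0; have t1 : 1 + t != 0 by rewrite gt_eqF// ltr_wpDl.
have d1 : is_derive t 1 (fun r : R => 1 + r) 1.
  by rewrite -[X in is_derive _ _ _ X]add0r; exact: derive_add.
have d2 := derive_mul d1 d1.
have := @is_deriveV _ _ t _ 1 (mulf_neq0 t1 t1) d2.
rewrite (_ : (fun y => _) = cutoff); last by apply/funext => r; rewrite /cutoff expr2.
by congr is_derive; rewrite /GRing.scale/= /damping /cutoff; field.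
Qed.

Let cut_derive i t : 0 < t -> is_derive t 1 (cut_solution i)
  (- damping t * cut_solution i t +
   cutoff t * ((g * (D i 0 * (ap * t `^ g)) - g * (D i 1 * (am * t `^ (- g)))) / t)).
Proof.
move=> t0; rewrite /cut_solution.
rewrite (_ : - damping t * (_ * _) = - damping t * cutoff t * power_solution i t).
  exact: derive_mul (cutoff_derive t0) (power_solution_derive i t0).
by rewrite mulrA.
Qed.

Let cut_continuous i t : 0 < t -> {for t, continuous (cut_solution i)}.
Proof. by move=> t0; exact: is_derive_continuous (cut_derive i t0). Qed.

Let damping_continuous t : 0 < t -> {for t, continuous damping}.
Proof.
move=> t0; apply: cvgM; first exact: cvg_cst.
apply: cvgV; first by rewrite gt_eqF// ltr_wpDl.
by apply: cvgD; [exact: cvg_cst|exact: cvg_id].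
Qed.

(** The image under the maximal operator: the terms in 1/r cancel, the mass term
    and the derivative of the cut-off remain. *)
Definition cut_image1 r := m * cut_solution 0 r + damping r * cut_solution 1 r.
Definition cut_image2 r := - m * cut_solution 1 r - damping r * cut_solution 0 r.

Lemma cut_dirac_system : dirac_system m nu mu lambda k
  (cut_solution 0) (cut_solution 1) cut_image1 cut_image2.
Proof.
have cdiv (c : R) t : 0 < t -> {for t, continuous (fun r : R => c / r)}.
  by move=> t0; apply: cvgM; [exact: cvg_cst|apply: cvgV; [rewrite gt_eqF|exact: cvg_id]].
have cc (c : R) t : {for t, continuous (fun _ : R => c)} by exact: cvg_cst.
have c0 t : 0 < t -> {for t, continuous (cut_solution 0)} by exact: cut_continuous.
have c1 t : 0 < t -> {for t, continuous (cut_solution 1)} by exact: cut_continuous.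
have e1 := Dmx_col0_eigen1 delta_gt0; have e2 := Dmx_col0_eigen2 delta_gt0.
have e3 := Dmx_col1_eigen1 delta_gt0; have e4 := Dmx_col1_eigen2 delta_gt0.
rewrite -/kap -/g -/D in e1 e2 e3 e4.
split; apply: derive_primitive => t t0.
- rewrite (_ : 1 * _ = - damping t * cut_solution 1 t +
   cutoff t * ((g * (D 1 0 * (ap * t `^ g)) - g * (D 1 1 * (am * t `^ (- g)))) / t)).
    exact: cut_derive.
  transitivity (- damping t * cut_solution 1 t + cutoff t *
     ((((nu + mu) * D 0 0 + kap * D 1 0) * (ap * t `^ g) +
       ((nu + mu) * D 0 1 + kap * D 1 1) * (am * t `^ (- g))) / t)).
    by rewrite /cut_image1 /cut_solution /power_solution -/kap; ring.
  by rewrite e2 e4; ring.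
- apply: cvgM; first exact: cc.
  apply: cvgB.
    apply: cvgD; apply: cvgM; [|exact: c0|exact: cdiv|exact: c1].
    by apply: cvgD; [exact: cc|exact: cdiv].
  apply: cvgD; apply: cvgM; [exact: cc|exact: c0|exact: damping_continuous|exact: c1].
- rewrite (_ : -1 * _ = - damping t * cut_solution 0 t +
   cutoff t * ((g * (D 0 0 * (ap * t `^ g)) - g * (D 0 1 * (am * t `^ (- g)))) / t)).
    exact: cut_derive.
  transitivity (- damping t * cut_solution 0 t + cutoff t *
     (((- kap * D 0 0 - (nu - mu) * D 1 0) * (ap * t `^ g) +
       (- kap * D 0 1 - (nu - mu) * D 1 1) * (am * t `^ (- g))) / t)).
    by rewrite /cut_image2 /cut_solution /power_solution -/kap; ring.
  by rewrite e1 e3; ring.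
- apply: cvgM; first exact: cc.
  apply: cvgB.
    apply: cvgD; apply: cvgM; [exact: cdiv|exact: c0| |exact: c1].
    by apply: cvgD; [exact: cc|exact: cdiv].
  apply: cvgB; apply: cvgM; [exact: cc|exact: c1|exact: damping_continuous|exact: c0].
Qed.

Let bound i : R := `|D i 0 * ap| + `|D i 1 * am|.

Let power_solution_le1 i r : 0 < r <= 1 -> `|power_solution i r| <= bound i * r `^ (- g).
Proof.
move=> /andP[r0 r1]; rewrite /power_solution !mulrA mulrDl.
apply: le_trans (ler_normD _ _) _; rewrite !normrM ![`|_ `^ _|]ger0_norm ?powR_ge0//.
apply: lerD; last by [].
rewrite ler_wpM2l ?mulr_ge0//; apply: ger_powR; first by rewrite r0.
by have : 0 < g := g0; lra.
Qed.

Let power_solution_ge1 i r : 1 <= r -> `|power_solution i r| <= bound i * r.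
Proof.
move=> r1; have r0 : 0 < r by exact: lt_le_trans r1.
rewrite /power_solution !mulrA mulrDl.
apply: le_trans (ler_normD _ _) _; rewrite !normrM ![`|_ `^ _|]ger0_norm ?powR_ge0//.
have g1 : 0 < g < 2^-1 by rewrite g0.
by apply: lerD; rewrite ler_wpM2l ?mulr_ge0//; apply: ler1_powR => //; lra.
Qed.

Lemma damping_sqint_of f : sqint f -> sqint (fun r => damping r * f r).
Proof.
move=> [mf sf]; apply: (@sqint_dominated _ _ (fun r => 4 * f r ^+ 2)).
- apply: measurable_funM => //; apply: continuous_measurable_half.
  exact: damping_continuous.
- exact: (integrableZl measurable_half_line 4 sf).
- move=> r r0; rewrite exprMn ler_wpM2r ?sqr_ge0//.
  have d0 : 0 <= damping r by rewrite divr_ge0// addr_ge0// ltW.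
  have d2 : damping r <= 2 by rewrite ler_pdivrMr ?ltr_wpDl//; lra.
  nra.
Qed.

Lemma cut_sqint i : sqint (cut_solution i).
Proof.
have p1 : - 1 < - 2 * g by have : g < 2^-1 := gamma_lt; lra.
apply: (@sqint_dominated _ _ (fun r => bound i ^+ 2 * power_envelope (- 2 * g) r)).
- by apply: continuous_measurable_half => t; exact: cut_continuous.
- exact: (integrableZl measurable_half_line _ (power_envelope_integrable p1)).
- move=> r r0; have b0 : 0 <= bound i by rewrite addr_ge0.
  have c0 : 0 <= cutoff r by rewrite invr_ge0 sqr_ge0.
  have r10 : 0 < 1 + r by rewrite ltr_wpDl.
  have sq (x : R) : `|cut_solution i r| <= bound i * x -> 0 <= x ->
      cut_solution i r ^+ 2 <= bound i ^+ 2 * x ^+ 2.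
    move=> h x0; rewrite -exprMn -real_normK ?num_real//.
    by rewrite lerXn2r ?nnegrE// mulr_ge0.
  have normE : `|cut_solution i r| = cutoff r * `|power_solution i r|.
    by rewrite normrM (ger0_norm c0).
  have [r1|r1] := leP r 1.
    have -> : power_envelope (- 2 * g) r = (r `^ (- g)) ^+ 2.
      rewrite /power_envelope -powR_mulrn ?powR_ge0// -powRrM.
      rewrite (_ : - g * 2%:R = - 2 * g); last by ring.
      by apply/min_idPl; apply: ger_powR; [rewrite r0|have : g < 2^-1 := gamma_lt; lra].
    apply: sq; last exact: powR_ge0.
    rewrite normE (@le_trans _ _ (`|power_solution i r|))//.
      rewrite ler_piMl// /cutoff invf_le1 ?exprn_gt0// exprn_ege1//; lra.
    by apply: power_solution_le1; rewrite r0.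
  have -> : power_envelope (- 2 * g) r = (r^-1) ^+ 2.
    rewrite /power_envelope exprVn -powR_invn ?ltW//.
    by apply/min_idPr; apply: ler_powR; [exact: ltW|have : g < 2^-1 := gamma_lt; lra].
  apply: sq; last by rewrite invr_ge0 ltW.
  rewrite normE; apply: (@le_trans _ _ (cutoff r * (bound i * r))).
    by rewrite ler_wpM2l// power_solution_ge1// ltW.
  rewrite mulrCA ler_wpM2l// /cutoff -[leRHS]mul1r ler_pdivlMr// -mulrA mulrC.
  by rewrite ler_pdivrMr ?exprn_gt0// mul1r; nra.
Qed.

Lemma cut_image1_sqint : sqint cut_image1.
Proof.
apply: sqintD; first by apply: sqintZ; exact: cut_sqint.
by apply: damping_sqint_of; exact: cut_sqint.
Qed.

Lemma cut_image2_sqint : sqint cut_image2.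
Proof.
have := sqintD (sqintZ (- m) (cut_sqint 1))
  (sqintZ (-1) (damping_sqint_of (cut_sqint 0))).
by congr sqint; apply/funext => r; rewrite /cut_image2 mulN1r.
Qed.

Definition cut_spinor : spinor R :=
  (fun r => (cut_solution 0 r)%:C, fun r => (cut_solution 1 r)%:C).

(** Only the singular branch contributes to phi^-. *)
Lemma cut_phi_minus r :
  phi_minus nu mu lambda k cut_spinor r = (cutoff r * (am * r `^ (- g)))%:C.
Proof.
rewrite phi_minusE -/al -/be -!rmorphM -rmorphD; congr _%:C.
have e1 := phi_coef_Dmx_col0 nu mu lambda k.
have e2 := phi_coef_Dmx_col1 delta_gt0.
rewrite -/al -/be -/D in e1 e2.
transitivity (cutoff r * ((al * D 0 0 + be * D 1 0) * (ap * r `^ g) +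
                          (al * D 0 1 + be * D 1 1) * (am * r `^ (- g)))).
  by rewrite /cut_solution /power_solution; ring.
by rewrite e1 e2; ring.
Qed.

(** The cut-off alters the solution by O(r) O(r^(-g)), which is o(r^(1/2)) because
    g < 1/2. *)
Lemma cut_boundary theta : ap * sin theta + am * cos theta = 0 ->
  boundary_cond nu mu lambda k theta cut_spinor.
Proof.
move=> apm; exists ap%:C, am%:C; split.
  by rewrite -!rmorphM -rmorphD apm.
pose S := 2 * (bound 0 + bound 1).
apply: (squeeze_cvgr (f := fun=> 0) (h := fun r => S * r `^ (2^-1 - g))).
- near=> r.
  have r0 : 0 < r by near: r; exact: nbhs_right_gt.
  have r1 : r <= 1 by near: r; apply: nbhs_right_le; exact: ltr01.
  rewrite mulr_ge0 ?sqrtr_ge0 ?powR_ge0//=.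
  have entry i : normc ((if i == 0 then cut_spinor.1 r else cut_spinor.2 r) -
      ((D i 0)%:C * (ap%:C * (r `^ g)%:C) + (D i 1)%:C * (am%:C * (r `^ (- g))%:C)))
      <= 2 * r * (bound i * r `^ (- g)).
    have -> : (if i == 0 then cut_spinor.1 r else cut_spinor.2 r) =
        (cut_solution i r)%:C.
      by case: i => -[|[|//]] h /=; congr (cut_solution _ r)%:C; apply/val_inj.
    rewrite -!rmorphM -rmorphD -/(power_solution i r) -rmorphB normc_real.
    rewrite (_ : _ - _ = (cutoff r - 1) * power_solution i r); last first.
      by rewrite /cut_solution; ring.
    rewrite normrM; apply: ler_pM => //; last by apply: power_solution_le1; rewrite r0.
    have r10 : 0 < (1 + r) ^+ 2 by rewrite exprn_gt0// ltr_wpDl.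
    have c1 : ((1 + r) ^+ 2)^-1 <= 1.
      by rewrite invf_le1// exprn_ege1// lerDl ltW.
    have c2 : 1 - 2 * r <= ((1 + r) ^+ 2)^-1.
      by rewrite -[leRHS]mul1r ler_pdivlMr//; nra.
    by rewrite ler_norml /cutoff; apply/andP; split; lra.
  apply: (@le_trans _ _ (S * r * r `^ (- g) * r `^ (- 2^-1))).
    rewrite ler_wpM2r ?powR_ge0//; apply: le_trans (norm_C2_le _) _.
    rewrite !boundary_entry; apply: le_trans (lerD (entry 0) (entry 1)) _.
    by rewrite le_eqVlt; apply/orP; left; apply/eqP; rewrite /S; ring.
  rewrite -!mulrA !ler_wpM2l// ?addr_ge0//.
  rewrite -{1}[r]powRr1 ?(ltW r0)// -!powRD; try by apply/implyP => _; rewrite gt_eqF.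
  rewrite (_ : 1 + (- g + - 2^-1) = 2^-1 - g) ?lexx//; by field.
- exact: cvg_cst.
- rewrite -[X in _ --> X](mulr0 S); apply: cvgM; first exact: cvg_cst.
  by apply: powR_cvg0; rewrite subr_gt0.
Unshelve. all: by end_near. Qed.

Lemma cut_dom theta : ap * sin theta + am * cos theta = 0 ->
  dom (t_op m nu mu lambda k theta) cut_spinor.
Proof.
move=> apm; exists (fun r => (cut_image1 r)%:C, fun r => (cut_image2 r)%:C).
split; last exact: cut_boundary.
apply: dirac_system_h_max.
- exact: cut_sqint.
- exact: cut_sqint.
- exact: cut_image1_sqint.
- exact: cut_image2_sqint.
- exact: cut_dirac_system.
Qed.

Lemma cut_phi_minus_lower r : 0 < r <= 1 ->
  (am / 4) ^+ 2 <= (cutoff r * (am * r `^ (- g))) ^+ 2.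
Proof.
move=> /andP[r0 r1]; rewrite mulrCA !(exprMn _ am).
rewrite ler_wpM2l ?sqr_ge0//.
have q : 4^-1 <= cutoff r.
  rewrite /cutoff lef_pV2 ?posrE ?exprn_gt0 ?ltr_wpDl//; nra.
have p : 1 <= r `^ (- g).
  rewrite -[leLHS](powRr0 r); apply: ger_powR; first by rewrite r0.
  by rewrite oppr_le0 ltW.
rewrite lerXn2r ?nnegrE ?invr_ge0//.
  by rewrite mulr_ge0 ?powR_ge0// (le_trans _ q)// invr_ge0.
apply: (le_trans q); rewrite ler_peMr// (le_trans _ q)// invr_ge0//.
Qed.

End SingularSolution.

(** * The characterization *)

Section Characterization.
Context {R : realType}.
Variables (m nu mu lambda : R) (k : int).
Hypothesis delta_itv : 0 < delta nu mu lambda k < 4^-1.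
Let g : R := gamma nu mu lambda k.
Let al : R := phi_coef1 nu mu lambda k.
Let be : R := phi_coef2 nu mu lambda k.

Let delta_gt0 : 0 < delta nu mu lambda k. Proof. by case/andP: delta_itv. Qed.

Lemma gamma_lt_half : gamma nu mu lambda k < 2^-1.
Proof.
have [_ d4] := andP delta_itv.
rewrite -(@ltr_pXn2r _ 2) ?nnegrE ?sqrtr_ge0 ?invr_ge0//.
by rewrite sqr_sqrtr ?ltW// exprVn -natrX.
Qed.

Lemma distinguished_dom_pow a : 2^-1 <= a < 2^-1 + g ->
  dom (t_op m nu mu lambda k 0) `<=` spinor_dom_pow a.
Proof.
move=> /andP[a2 ag] F [G [[[LF1 LF2] _ _ _ _] bc]].
have [C [c [c01 H]]] := boundary0_growth gamma_lt_half bc.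
have a0 : 0 <= a by apply: le_trans a2; rewrite invr_ge0.
have pow (f : R -> R[i]) : L2 f ->
    (forall r, 0 < r < c -> normc (f r) <= C * r `^ g) -> dom_pow a f.
  move=> Lf fC; split=> //; have /L2P[sr si] := Lf; apply/L2P.
  rewrite reF_scale imF_scale; split.
    apply: (sqint_powR sr c01 a0 ag) => r rc.
    exact: le_trans (Re_le_normc _) (fC r rc).
  apply: (sqint_powR si c01 a0 ag) => r rc.
  exact: le_trans (Im_le_normc _) (fC r rc).
by split; apply: pow => // r rc; have [] := H r rc.
Qed.

Lemma distinguished_in_J F : dom (t_op m nu mu lambda k 0) F ->
  in_J (phi_minus nu mu lambda k F).
Proof.
move=> [G [hF bc]]; have [[/L2P[s1r s1i] /L2P[s2r s2i]] _ LG _ _] := hF.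
have [/L2P[t1r t1i] /L2P[t2r t2i]] := LG.
have [sysr sysi] := h_max_dirac_system hF.
have [c c0 H] := boundary0_phi_minus bc.
have reE : reF (phi_minus nu mu lambda k F) =
    fun r => al * reF F.1 r + be * reF F.2 r.
  by apply/funext => r; rewrite {1}/reF phi_minusE ReD !ReMr.
have imE : imF (phi_minus nu mu lambda k F) =
    fun r => al * imF F.1 r + be * imF F.2 r.
  by apply/funext => r; rewrite {1}/imF phi_minusE ImD !ImMr.
have Hr r : 0 < r < c -> reF (phi_minus nu mu lambda k F) r ^+ 2 <= r.
  move=> /H; apply: le_trans; rewrite -real_normK ?num_real//.
  by rewrite lerXn2r ?nnegrE ?normc_nonneg// Re_le_normc.
have Hi r : 0 < r < c -> imF (phi_minus nu mu lambda k F) r ^+ 2 <= r.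
  move=> /H; apply: le_trans; rewrite -real_normK ?num_real//.
  by rewrite lerXn2r ?nnegrE ?normc_nonneg// Im_le_normc.
have Hr' := Hr; have Hi' := Hi; rewrite reE in Hr'; rewrite imE in Hi'.
have [qr [wr swr pr]] := phi_minus_regular delta_gt0 sysr s1r s2r t1r t2r c0 Hr'.
have [qi [wi swi pi]] := phi_minus_regular delta_gt0 sysi s1i s2i t1i t2i c0 Hi'.
apply: (@primitive_in_J _ _ wr wi c) => //; rewrite ?reE ?imE//.
Qed.

Section NonDistinguished.
Variables (theta : R).
Hypothesis theta_itv : 0 <= theta < pi.
Hypothesis theta_neq0 : theta != 0.

Let sin_pos : 0 < sin theta.
Proof.
apply: sin_gt0_pi; have /andP[t0 ->] := theta_itv.
by rewrite lt_neqAle eq_sym theta_neq0 t0.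
Qed.

Let F : spinor R := cut_spinor nu mu lambda k (- cos theta) (sin theta).

Let domF : dom (t_op m nu mu lambda k theta) F.
Proof.
by apply: cut_dom => //; [exact: gamma_lt_half|ring].
Qed.

Let phiF r : phi_minus nu mu lambda k F r =
  (cutoff r * (sin theta * r `^ (- g)))%:C.
Proof. exact: cut_phi_minus. Qed.

Let lower0 : 0 < (sin theta / 4) ^+ 2.
Proof. by rewrite exprn_gt0// divr_gt0. Qed.

(** Up to 1, r^(-1/2) phi^- has a square of at least (sin theta / 4)^2 / r. *)
Lemma singular_not_dom_pow :
  ~ (dom (t_op m nu mu lambda k theta) `<=` spinor_dom_pow 2^-1).
Proof.
move=> /(_ F domF)[[_ /L2P[s1 _]] [_ /L2P[s2 _]]].
rewrite reF_scale in s1; rewrite reF_scale in s2.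
apply: (inv_not_sqint lower0 _ (sqintD (sqintZ al s1) (sqintZ be s2))).
move=> t t01; have /andP[t0 _] := t01.
rewrite (_ : _ + _ = t `^ (- 2^-1) * reF (phi_minus nu mu lambda k F) t); last first.
  by rewrite [in RHS]/reF phi_minusE ReD !ReMr -/al -/be; rewrite /reF; ring.
rewrite [leRHS]exprMn powRN (powR12_sqrt (ltW t0)) exprVn sqr_sqrtr ?(ltW t0)//.
rewrite [leRHS]mulrC.
rewrite ler_wpM2r ?invr_ge0 ?(ltW t0)// /reF phiF.
exact: cut_phi_minus_lower.
Qed.

Lemma singular_not_in_J : ~ in_J (phi_minus nu mu lambda k F).
Proof.
move=> [v [w [_ _ /L2P[sq _] _ _]]].
apply: (inv_not_sqint lower0 _ sq) => t t01; have /andP[t0 t1] := t01.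
rewrite [X in _ <= X ^+ 2]/reF -fmorphV ReMl phiF /= [leRHS]exprMn ler_pM//.
- by rewrite sqr_ge0.
- by rewrite invr_ge0 ltW.
- exact: cut_phi_minus_lower.
- by rewrite expr2 ler_peMl ?invr_ge0 ?(ltW t0)// invf_ge1.
Qed.

End NonDistinguished.

End Characterization.

Theorem proposition1p7 (R : realType) (m nu mu lambda : R) (k : int)
    (hk : k != 0)
    (hdelta : 0 < delta nu mu lambda k < 4^-1)
    (theta : R) (htheta : 0 <= theta < pi) :
  [<-> theta = 0;
       dom (t_op m nu mu lambda k theta) `<=` spinor_dom_pow 2^-1;
       forall a : R, 2^-1 <= a < 2^-1 + gamma nu mu lambda k ->
         dom (t_op m nu mu lambda k theta) `<=` spinor_dom_pow a;
       forall F : spinor R, dom (t_op m nu mu lambda k theta) F ->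
         in_J (phi_minus nu mu lambda k F)].
Proof.
have half_itv : 2^-1 <= (2^-1 : R) < 2^-1 + gamma nu mu lambda k.
  by rewrite lexx ltrDl gamma_gt0//; case/andP: hdelta.
have ii_i : dom (t_op m nu mu lambda k theta) `<=` spinor_dom_pow 2^-1 -> theta = 0.
  move=> H; apply: contrapT => /eqP t0.
  exact: (singular_not_dom_pow hdelta htheta t0 H).
tfae.
- by move=> ->; exact: distinguished_dom_pow.
- by move=> /ii_i -> a; exact: distinguished_dom_pow.
- by move=> /(_ _ half_itv)/ii_i -> F; exact: distinguished_in_J.
- move=> H; apply: contrapT => /eqP t0.
  apply: (singular_not_in_J hdelta htheta t0); apply: H.
  by apply: cut_dom; [case/andP: hdelta|exact: gamma_lt_half|ring].
Qed.
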